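(* There exist the following examples of vector fields and flows. (1) A vector field with a compact invariant set $\Lambda$ containing singularities (at least one) accumulated by regular orbits inside $\Lambda$, and with a continuous, $DX_t$-invariant, non-dominated splitting $T_\Lambda M=E\oplus F$ of the tangent space over $\Lambda$ such that $E$ is uniformly contracted and $F$ is sectionally expanding. (2) A vector field with a compact invariant set $\Lambda$ with a continuous and $DX_t$-invariant splitting $T_\Lambda M=E\oplus F$ such that $E$ is uniformly contracted and $F$ is area expanding, but the splitting is not dominated. (3) A suspension flow whose base map has a dominated splitting but such that the flow does not admit any dominated splitting.
   Context: $\{X_t\}$ denotes the flow generated by a vector field $X$ on a finite-dimensional Riemannian manifold $M$, and $DX_t$ its derivative. A set $\Lambda$ is invariant if $X_t(\Lambda)=\Lambda$ for all $t\in\mathbb{R}$. A singularity is a point $\sigma$ with $X(\sigma)=0$; a regular orbit is the orbit of a point where $X\ne0$. A splitting is $DX_t$-invariant if $DX_t$ maps each fiber at $x$ onto the corresponding fiber at $X_t(x)$. A subbundle $E$ is uniformly contracted if there are $C,\lambda>0$ with $\|DX_t|_{E_x}\|\le Ce^{-\lambda t}$ for all $x\in\Lambda$, $t\ge0$. A $DX_t$-invariant subbundle $F$ is sectionally expanding (also: area expanding) if $\dim F_x\ge2$ is constant for $x\in\Lambda$ and there are $C,\lambda>0$ such that $|\det(DX_t|_{L_x})|>Ce^{\lambda t}$ for every $x\in\Lambda$, every two-dimensional subspace $L_x\subset F_x$ and all $t>0$. A dominated splitting over a compact invariant set $\Lambda$ of a flow is a continuous $DX_t$-invariant splitting $T_\Lambda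 M=E\oplus F$ with $E_x\ne\{0\}$, $F_x\neq\{0\}$ for every $x\in\Lambda$, such that there are $K,\lambda>0$ with $\|DX_t|_{E_x}\|\cdot\|DX_{-t}|_{F_{X_t(x)}}\|<Ke^{-\lambda t}$ for all $x\in\Lambda$ and all $t>0$. For a diffeomorphism $f$ the definition is the same with $DX_t$ replaced by $Df^n$, $n\ge1$. In (3), the base map is a diffeomorphism $f$ of a compact manifold $N$, the suspension flow is the flow by translation in the second coordinate on the quotient of $N\times\mathbb{R}$ induced by $f$ and a roof function, and the dominated splittings are over the whole manifolds. *)

(* Defs.v *)
From HB Require Import structures.
From mathcomp Require Import all_boot all_order all_algebra.
From mathcomp Require Import all_classical all_reals all_analysis.

Set Implicit Arguments.
Unset Strict Implicit.
Unset Printing Implicit Defensive.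
Import Order.TTheory GRing.Theory Num.Theory.
Import numFieldNormedType.Exports.
Local Open Scope classical_set_scope.
Local Open Scope ring_scope.

(* Ck k U f is meant for open sets U: it only depends on f near the points of
   U, and asks that the iterated directional derivatives of f up to order k
   exist and are continuous on U. *)
Fixpoint Ck (R : realType) (V W : normedModType R) (k : nat) (U : set V)
    (f : V -> W) : Prop :=
  match k with
  | 0%N => forall x, U x -> {for x, continuous f}
  | k'.+1 => (forall x, U x -> differentiable f x) /\
             (forall v, Ck k' U ('D_v f))
  end.

Definition smooth_on (R : realType) (V W : normedModType R) (U : set V)
  (f : V -> W) : Prop := forall k, Ck k U f.

(* A chart is a homeomorphism from the open set chart_dom c onto the open set
   chart_img c of R^n.  The functions chart_map and chart_inv are total; their
   values off these two sets are irrelevant. *)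
Record chart (R : realType) (n : nat) (T : Type) := Chart {
  chart_dom : set T;
  chart_map : T -> 'rV[R]_n;
  chart_inv : 'rV[R]_n -> T }.

Definition chart_img (R : realType) (n : nat) (T : Type) (c : chart R n T) :
  set 'rV[R]_n := chart_map c @` chart_dom c.

Definition is_chart (R : realType) (n : nat) (T : topologicalType)
    (c : chart R n T) : Prop :=
  [/\ open (chart_dom c), open (chart_img c),
      {within chart_dom c, continuous (chart_map c)},
      {within chart_img c, continuous (chart_inv c)}
    & forall x, chart_dom c x -> chart_inv c (chart_map c x) = x].

(* An atlas comes with a preferred chart around each point; the atlas proper
   is the family of all these charts. *)
Definition atlas (R : realType) (n : nat) (T : Type) := T -> chart R n T.

Definition is_smooth_atlas (R : realType) (n : nat) (T : topologicalType)
    (A : atlas R n T) : Prop :=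
  [/\ forall p, is_chart (A p),
      forall p, chart_dom (A p) p
    & forall p q,
        smooth_on (chart_map (A p) @` (chart_dom (A p) `&` chart_dom (A q)))
                  (chart_map (A q) \o chart_inv (A p))].

Record manifold (R : realType) (n : nat) := Manifold {
  pts :> topologicalType;
  charts : atlas R n pts;
  manifold_hausdorff : hausdorff_space pts;
  manifold_second_countable : @second_countable pts;
  manifold_smooth : is_smooth_atlas charts }.

Definition smooth_map_on (R : realType) (m n : nat) (S T : topologicalType)
    (A : atlas R m S) (B : atlas R n T) (O : set S) (f : S -> T) : Prop :=
  {within O, continuous f} /\
  forall p q,
    smooth_on
      (chart_map (A p) @` (O `&` chart_dom (A p) `&` f @^-1` chart_dom (B q)))
      (chart_map (B q) \o f \o chart_inv (A p)).

Definition smooth_map (R : realType) (m n : nat) (S T : topologicalType)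
    (A : atlas R m S) (B : atlas R n T) (f : S -> T) : Prop :=
  smooth_map_on A B [set: S] f.

Definition smooth_fun (R : realType) (n : nat) (M : manifold R n)
    (r : M -> R) : Prop :=
  forall p, smooth_on (chart_img (charts p)) (r \o chart_inv (charts p)).

Definition prod_atlas (R : realType) (n : nat) (T : Type) (A : atlas R n T) :
    atlas R (n + 1) (T * R)%type :=
  fun p => Chart (chart_dom (A p.1) `*` [set: R])
    (fun z => row_mx (chart_map (A p.1) z.1) (z.2%:M : 'rV[R]_1))
    (fun w => (chart_inv (A p.1) (lsubmx w), rsubmx w ord0 ord0)).

(* The tangent space at every point x of an n-manifold is 'rV[R]_n: a row
   vector stands for the tangent vector with these coordinates in the preferred
   chart at x.  tangent_map f x is the derivative of f at x through this
   identification, and tangent_coord p x maps a tangent vector at x to its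
   coordinates in the chart at p, for x in the domain of that chart. *)
Definition tangent_map (R : realType) (m n : nat) (M : manifold R m)
    (N : manifold R n) (f : M -> N) (x : M) : 'Hom('rV[R]_m, 'rV[R]_n) :=
  linfun ('d (chart_map (charts (f x)) \o f \o chart_inv (charts x))
             (chart_map (charts x) x)).

Definition tangent_coord (R : realType) (n : nat) (M : manifold R n)
    (p x : M) : 'Hom('rV[R]_n, 'rV[R]_n) :=
  linfun ('d (chart_map (charts p) \o chart_inv (charts x))
             (chart_map (charts x) x)).

(* Inverse of tangent_coord p x. *)
Definition tangent_of_coord (R : realType) (n : nat) (M : manifold R n)
    (p x : M) : 'Hom('rV[R]_n, 'rV[R]_n) :=
  linfun ('d (chart_map (charts x) \o chart_inv (charts p))
             (chart_map (charts p) x)).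

Definition bilin (R : realType) (n : nat) (g : 'M[R]_n) (u v : 'rV[R]_n) : R :=
  (u *m g *m v^T) ord0 ord0.

Definition is_metric (R : realType) (n : nat) (M : manifold R n)
    (g : M -> 'M[R]_n) : Prop :=
  [/\ forall x, (g x)^T = g x,
      forall x v, v != 0 -> 0 < bilin (g x) v v
    & forall p u v, smooth_on (chart_img (charts p))
        (fun w : 'rV[R]_n => let x := chart_inv (charts p) w in
           bilin (g x) (tangent_of_coord p x u) (tangent_of_coord p x v))].

Record riemannian (R : realType) (n : nat) := Riemannian {
  rmanifold :> manifold R n;
  metric : rmanifold -> 'M[R]_n;
  metric_axiom : is_metric metric }.

Definition tnorm (R : realType) (n : nat) (M : riemannian R n) (x : M)
    (v : 'rV[R]_n) : R := Num.sqrt (bilin (metric x) v v).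

Definition opnorm (R : realType) (n : nat) (M : riemannian R n) (f : M -> M)
    (x : M) (V : {vspace 'rV[R]_n}) : R :=
  sup [set tnorm (f x) (tangent_map f x v) |
        v in [set v | v \in V /\ tnorm x v <= 1]].

Definition gram (R : realType) (n : nat) (M : riemannian R n) (x : M)
    (k : nat) (e : 'I_k -> 'rV[R]_n) : R :=
  \det (\matrix_(i < k, j < k) bilin (metric x) (e i) (e j)).

(* Absolute value of the determinant of Df_x : L -> Df_x(L) in orthonormal
   bases, i.e. the factor by which it changes (dim L)-dimensional volume; it is
   computed here in an arbitrary basis of L, on which it does not depend. *)
Definition absdet (R : realType) (n : nat) (M : riemannian R n) (f : M -> M)
    (x : M) (L : {vspace 'rV[R]_n}) : R :=
  let e := fun i : 'I_(\dim L) => (vbasis L)`_i in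
  Num.sqrt (gram (f x) (fun i => tangent_map f x (e i)))
    / Num.sqrt (gram x e).

Definition smooth_vector_field (R : realType) (n : nat) (M : manifold R n)
    (X : M -> 'rV[R]_n) : Prop :=
  forall p, smooth_on (chart_img (charts p))
    (fun w : 'rV[R]_n => let x := chart_inv (charts p) w in
                         tangent_coord p x (X x)).

Definition smooth_flow (R : realType) (n : nat) (M : manifold R n)
    (phi : R -> M -> M) : Prop :=
  [/\ forall x, phi 0 x = x,
      forall s t x, phi (s + t) x = phi s (phi t x)
    & smooth_map (prod_atlas (@charts R n M)) (@charts R n M)
        (fun z : (M * R)%type => phi z.2 z.1)].

Definition generates (R : realType) (n : nat) (M : manifold R n)
    (X : M -> 'rV[R]_n) (phi : R -> M -> M) : Prop :=
  smooth_flow phi /\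
  forall x t, is_derive t (1 : R)
    (fun s : R => chart_map (charts (phi t x)) (phi s x)) (X (phi t x)).

(* iterz f finv k is the k-th iterate of a bijection f with inverse finv. *)
Definition iterz (T : Type) (f finv : T -> T) (k : int) : T -> T :=
  match k with
  | Posz j => iter j f
  | Negz j => iter j.+1 finv
  end.

Definition diffeomorphism (R : realType) (n : nat) (M : manifold R n)
    (f finv : M -> M) : Prop :=
  [/\ cancel f finv, cancel finv f,
      smooth_map (@charts R n M) (@charts R n M) f
    & smooth_map (@charts R n M) (@charts R n M) finv].

Definition invariant_set (T : Type) (I : Type) (Phi : I -> T -> T)
  (L : set T) : Prop := forall t, Phi t @` L = L.

(* Near each point of L, the fibers of E are spanned by a continuous frame. *)
Definition continuous_subbundle (R : realType) (n : nat) (M : manifold R n)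
    (L : set M) (E : M -> {vspace 'rV[R]_n}) : Prop :=
  forall p, L p -> exists (k : nat) (e : 'I_k -> M -> 'rV[R]_n) (U : set M),
    [/\ open U, U p, U `<=` chart_dom (charts p),
        forall i, {within U `&` L, continuous (e i)}
      & forall x, (U `&` L) x ->
          basis_of (tangent_coord p x @: E x)%VS [seq e i x | i <- enum 'I_k]].

Definition invariant_subbundle (R : realType) (n : nat) (M : manifold R n)
    (I : Type) (Phi : I -> M -> M) (L : set M)
    (E : M -> {vspace 'rV[R]_n}) : Prop :=
  forall t x, L x -> (tangent_map (Phi t) x @: E x)%VS = E (Phi t x).

(* Splittings have nonzero fibers. *)
Definition continuous_invariant_splitting (R : realType) (n : nat)
    (M : manifold R n) (I : Type) (Phi : I -> M -> M) (L : set M)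
    (E F : M -> {vspace 'rV[R]_n}) : Prop :=
  [/\ forall x, L x -> [/\ E x != 0%VS, F x != 0%VS,
        (E x + F x)%VS = fullv & (E x :&: F x)%VS = 0%VS],
      continuous_subbundle L E, continuous_subbundle L F,
      invariant_subbundle Phi L E & invariant_subbundle Phi L F].

(* Flows and diffeomorphisms are both families of maps indexed by a group T of
   times, R or int; rho embeds these times
   into R. *)
Definition dominated_splitting (R : realType) (n : nat) (M : riemannian R n)
    (T : numDomainType) (rho : T -> R) (Phi : T -> M -> M) (L : set M)
    (E F : M -> {vspace 'rV[R]_n}) : Prop :=
  continuous_invariant_splitting Phi L E F /\
  exists K lambda : R, [/\ 0 < K, 0 < lambda &
    forall x t, L x -> 0 < t ->
      opnorm (Phi t) x (E x) * opnorm (Phi (- t)) (Phi t x) (F (Phi t x))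
        < K * expR (- (lambda * rho t))].

Definition flow_dominated_splitting (R : realType) (n : nat)
    (M : riemannian R n) (phi : R -> M -> M) (L : set M)
    (E F : M -> {vspace 'rV[R]_n}) : Prop :=
  dominated_splitting (fun t : R => t) phi L E F.

Definition diffeo_dominated_splitting (R : realType) (n : nat)
    (M : riemannian R n) (f finv : M -> M) (L : set M)
    (E F : M -> {vspace 'rV[R]_n}) : Prop :=
  dominated_splitting (fun k : int => k%:~R : R) (iterz f finv) L E F.

Definition uniformly_contracted (R : realType) (n : nat) (M : riemannian R n)
    (phi : R -> M -> M) (L : set M) (E : M -> {vspace 'rV[R]_n}) : Prop :=
  exists C lambda : R, [/\ 0 < C, 0 < lambda &
    forall x t, L x -> 0 <= t ->
      opnorm (phi t) x (E x) <= C * expR (- (lambda * t))].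

Definition sectionally_expanding (R : realType) (n : nat)
    (M : riemannian R n) (phi : R -> M -> M) (L : set M)
    (F : M -> {vspace 'rV[R]_n}) : Prop :=
  [/\ invariant_subbundle phi L F,
      exists2 d : nat, (2 <= d)%N & forall x, L x -> \dim (F x) = d
    & exists C lambda : R, [/\ 0 < C, 0 < lambda &
        forall x (P : {vspace 'rV[R]_n}) t, L x -> (P <= F x)%VS ->
          \dim P = 2%N -> 0 < t -> C * expR (lambda * t) < absdet (phi t) x P]].

(* s is a limit of points on regular orbits contained in L. *)
Definition limit_of_regular_orbits (R : realType) (n : nat)
    (M : manifold R n) (X : M -> 'rV[R]_n) (phi : R -> M -> M) (L : set M)
    (s : M) : Prop :=
  closure [set y | exists x, [/\ X x != 0, range (phi ^~ x) `<=` L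
                               & range (phi ^~ x) y]] s.

(* phi is the suspension flow of f with roof function r: pi is the projection
   of N x R onto its quotient by the Z-action generated by
   (x, s) |-> (f x, s - r x).  Being a surjective local diffeomorphism, pi
   determines both the topology and the smooth structure of the quotient M. *)
Definition is_suspension (R : realType) (n : nat) (N : manifold R n)
    (M : manifold R (n + 1)) (f : N -> N) (r : N -> R)
    (phi : R -> M -> M) : Prop :=
  let glue (z : (N * R)%type) := (f z.1, z.2 - r z.1) in
  exists pi : (N * R)%type -> M,
    [/\ set_surj [set: (N * R)%type] [set: M] pi,
        forall z w, pi z = pi w <->
          exists k : nat, iter k glue z = w \/ iter k glue w = z,
        smooth_map (prod_atlas (@charts R n N)) (@charts R _ M) pi,
        forall z, exists U : set (N * R)%type,
          [/\ open U, U z, open (pi @` U)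
            & exists2 inv : M -> (N * R)%type,
                smooth_map_on (@charts R _ M) (prod_atlas (@charts R n N))
                  (pi @` U) inv
              & forall w, U w -> inv (pi w) = w]
      & forall t x s, phi t (pi (x, s)) = pi (x, s + t)].

(* Main.v *)
Require Import Defs.
From HB Require Import structures.
From mathcomp Require Import all_boot all_order all_algebra.
From mathcomp Require Import all_classical all_reals all_analysis.
From mathcomp Require Import ring lra.

Set Implicit Arguments.
Unset Strict Implicit.
Unset Printing Implicit Defensive.
Import Order.TTheory GRing.Theory Num.Theory.
Import numFieldNormedType.Exports.
Local Open Scope classical_set_scope.
Local Open Scope ring_scope.

(* Everything is built from the flow [ang] induced on directions by the linear
   flow diag(1, exp(-t)) of the plane: it has a sink at angle 0 and a source at
   angle pi/2, with rates -1 and +1, and is given by a closed formula.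

   (1), (2): on R^3 take the product of this flow with y' = 2 y and z' = - z.
   Let Lambda be the arc from the source to the origin in the first axis, E the
   z-direction and F the plane of the first two directions.  Over Lambda the flow
   expands area in F at least like exp t, but at the origin both the z-direction
   and the first direction, which lies in F, are contracted exactly like
   exp(-t), so F does not dominate E.

   (3): the linear maps diag(1, exp(-t)) also act on the quotient of the punctured
   plane by the homothety of ratio exp(2 pi), a torus, and there the two
   coordinate directions form a dominated splitting for the scale invariant metric.
   In the direction of angle 0 the rates of the base map are (-1, 0), in the
   direction pi/2 they are (0, 1).  Suspending adds a direction of rate 0.  Hence
   a dominated splitting of the suspension flow must have dim E = 1 over
   the first periodic orbit and dim E = 2 over the second, contradicting
   the continuity of E. *)

(** * Iterated differentiability *)

Section Smoothness.
Variable R : realType.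
Implicit Types V W : normedModType R.

(** Every manifold here is R^n modulo a discrete group of translations, with the identity matrix as
    metric. Two charts then differ locally by a constant, so tangent maps are ordinary derivatives
    of lifts, and smoothness reduces to closed formulas on R^n; no existence theorem for
    differential equations is used. The difficulty with the flow on directions is that the angle is
    a real number: the group law has to hold exactly and not only modulo 2 pi. In (1) the rate 2 of
    y is picked to beat the rate -1 of the angle at the origin, and the rate -1 of z is picked to
    tie with it. In (3) the same number 2 pi is the period of the angle, the logarithm of the
    homothety ratio and the roof: in time 2 pi a vector of angle pi/2 is shrunk exactly by the
    homothety, so its class is fixed by the return map. *)

Lemma near_eq_diff V W (f g : V -> W) (x : V) :
  (\near x, f x = g x) -> differentiable g x ->
  differentiable f x /\ 'd f x = 'd g x :> (V -> W).
Proof.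
move=> fg dg.
have fgx : f x = g x := nbhs_singleton fg.
have cg : continuous ('d g x) by exact: diff_continuous.
have E : f \o shift x = cst (f x) + 'd g x +o_ 0 id.
  apply/eqaddoP => e e0.
  have := diff_locally dg => /eqaddoP /(_ e e0) H.
  have fg0 : \forall h \near (0 : V), f (h + x) = g (h + x).
    have : {for 0, continuous (fun h : V => h + x)}.
      by apply: cvgD; [exact: cvg_id|exact: cvg_cst].
    by move=> /(_ [set y | f y = g y]); rewrite /= add0r; exact.
  near=> h.
  have /= <- : (g \o shift x) h - (cst (g x) + 'd g x) h =
     ((f \o shift x) - (cst (f x) + 'd g x)) h.
    rewrite /= /GRing.add /= fgx; congr (_ - _).
    by apply/esym; near: h.
  by near: h; exact: H.
have D := diff_unique cg E; split => //.
by apply/diff_locallyP; rewrite D.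
Unshelve. all: by end_near. Qed.

Lemma Ck_ext V W k (U : set V) (f g : V -> W) : f =1 g -> Ck k U f -> Ck k U g.
Proof. by move=> /funext ->. Qed.

(** Lets chart expressions, meaningful only on part of R^n, be compared near each point of [U] with
    a globally smooth map; the comparison map [g] may change from point to point. *)
Lemma Ck_near V W k (U : set V) (f : V -> W) :
  (forall x, U x -> exists g : V -> W, (\near x, f x = g x) /\ Ck k setT g) ->
  Ck k U f.
Proof.
elim: k U f => [|k IH] U f H /=.
  move=> x /H[g [fg /(_ x I) cg]].
  rewrite /prop_for /continuous_at (nbhs_singleton fg).
  apply: cvg_trans cg; apply: near_eq_cvg.
  by near do apply/esym.
split=> [x /H[g [fg [/(_ x I) dg _]]]|v]; first by have [] := near_eq_diff fg dg.
apply: IH => x Ux; case: (H x Ux) => g [fg [_ Dg]]; exists (derive g ^~ v); split; last exact: Dg.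
(* Comparing derivatives at a nearby point [y] needs [f] and [g] to agree near [y], not just at [y];
   [near_join] supplies this. *)
have := near_join fg; apply: filterS => y /=.
by move=> fgy; rewrite (near_eq_derive _ fgy).
Unshelve. all: by end_near. Qed.

Lemma CkS V W k (f : V -> W) : Ck k.+1 setT f -> Ck k setT f.
Proof.
elim: k f => [|k IH] f [df Df].
  by move=> x _; exact/differentiable_continuous/df.
by split=> // v; apply: IH; exact: Df.
Qed.

Lemma Ck_const V W k (U : set V) (c : W) : Ck k U (cst c : V -> W).
Proof.
elim: k c => [|k IH] c /=; first by move=> x _; exact: cst_continuous.
split=> [x _|v]; first exact: differentiable_cst.
by apply: (Ck_ext _ (IH 0)) => x; rewrite derive_cst.
Qed.

Lemma Ck_linear V W k (U : set V) (f : {linear V -> W}) :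
  continuous f -> Ck k U f.
Proof.
case: k => [|k] cf /=; first by move=> x _; exact: cf.
split=> [x _|v]; first exact: linear_differentiable.
apply: (Ck_ext _ (Ck_const k U (f v))) => x.
by rewrite deriveE ?diff_lin//; exact: linear_differentiable.
Qed.

Lemma Ck_add V W k (f g : V -> W) :
  Ck k setT f -> Ck k setT g -> Ck k setT (fun x => f x + g x).
Proof.
elim: k f g => [|k IH] f g.
  by move=> cf cg x _; apply: cvgD; [exact: cf|exact: cg].
move=> [df Df] [dg Dg]; split=> [x _|v].
  by apply: (@differentiableD _ _ _ f g); [exact: df|exact: dg].
apply: (Ck_ext _ (IH _ _ (Df v) (Dg v))) => x.
by rewrite (@deriveD _ _ _ f g)//; apply: diff_derivable; [exact: df|exact: dg].
Qed.

Lemma Ck_mul V k (f g : V -> R) :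
  Ck k setT f -> Ck k setT g -> Ck k setT (fun x => f x * g x).
Proof.
elim: k f g => [|k IH] f g.
  by move=> cf cg x _; apply: cvgM; [exact: cf|exact: cg].
move=> kf kg; have [df Df] := kf; have [dg Dg] := kg; split=> [x _|v].
  by apply: (@differentiableM _ _ f g); [exact: df|exact: dg].
have := Ck_add (IH _ _ (CkS kf) (Dg v)) (IH _ _ (CkS kg) (Df v)).
apply: Ck_ext => x.
by rewrite (@deriveM _ _ f g)//; apply: diff_derivable; [exact: df|exact: dg].
Qed.

Lemma Ck_scalel V W k (f : V -> R) (c : W) :
  Ck k setT f -> Ck k setT (fun x => f x *: c).
Proof.
elim: k f => [|k IH] f.
  by move=> cf x _; apply: cvgZr_tmp; exact: cf.
move=> [df Df]; split=> [x _|v]; first exact/differentiableZl/df.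
apply: (Ck_ext _ (IH _ (Df v))) => x.
rewrite !deriveE ?diffZl//; first exact: df.
- exact/differentiableZl/df.
- exact: df.
Qed.

Lemma Ck_sum V W n k (f : 'I_n -> V -> W) :
  (forall i, Ck k setT (f i)) -> Ck k setT (fun x => \sum_(i < n) f i x).
Proof.
elim: n f => [|n IH] f H.
  by apply: (Ck_ext _ (Ck_const k setT 0)) => x; rewrite big_ord0.
apply: (Ck_ext _ (Ck_add (IH (fun i => f (widen_ord (leqnSn n) i)) _) (H ord_max))).
  by move=> x; rewrite big_ord_recr.
by move=> i; exact: H.
Qed.

Lemma Ck_row V n k (f : V -> 'rV[R]_n) :
  (forall i, Ck k setT (fun x => f x ord0 i)) -> Ck k setT f.
Proof.
move=> H.
apply: (Ck_ext _ (Ck_sum (fun i => Ck_scalel (delta_mx 0 i : 'rV_n) (H i)))).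
by move=> x; rewrite [RHS]row_sum_delta.
Qed.

Lemma Ck_coord n k (i : 'I_n) : Ck k setT (fun w : 'rV[R]_n => w ord0 i).
Proof.
pose f (w : 'rV[R]_n) := w ord0 i.
have lf : linear f by move=> a u v; rewrite /f !mxE.
pose fL : {linear 'rV[R]_n -> R} := HB.pack f (GRing.isLinear.Build _ _ _ _ _ lf).
apply: (@Ck_linear _ _ k setT fL); exact: coord_continuous.
Qed.

Lemma derive_comp1 V (h : R -> R) (f : V -> R) (x v : V) (dh : R) :
  differentiable f x -> is_derive (f x) (1 : R) h dh ->
  differentiable (h \o f) x /\ 'D_v (h \o f) x = dh * 'D_v f x.
Proof.
move=> df [dh1 dh2].
have dh' : differentiable h (f x) by exact/derivable1_diffP.
have dc : differentiable (h \o f) x by exact: differentiable_comp.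
split=> //; rewrite !deriveE// diff_comp//= deriv1E// derive1E dh2.
by rewrite /GRing.scale/= mulrC.
Qed.

(** Chain rule by induction on the order. The derivative [dh] may be an expression in [h] itself, as
    for the exponential and the inverse, so its smoothness is only asked below order [k], and given
    that of [h \o f]. The set [P] confines the values of [f] to where the derivative formula holds,
    such as the positive reals. *)
Lemma Ck_comp V k (P : set R) (h dh : R -> R) (f : V -> R) :
  (forall x, P (f x)) ->
  (forall y, P y -> is_derive y (1 : R) h (dh y)) ->
  (forall j, (j < k)%N -> Ck j setT f -> Ck j setT (h \o f) -> Ck j setT (dh \o f)) ->
  Ck k setT f -> Ck k setT (h \o f).
Proof.
move=> Pf hP; elim: k => [|k IH] dhP kf.
  move=> x _; apply: continuous_comp; first exact: kf.
  by apply/differentiable_continuous/derivable1_diffP; have [] := hP _ (Pf x).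
have [df Df] := kf.
have hd x v := derive_comp1 v (df x I) (hP _ (Pf x)).
split=> [x _|v]; first by have [] := hd x 0.
have kh : Ck k setT (h \o f).
  by apply: IH; [move=> j jk; apply: dhP; exact: ltnW|exact: CkS].
have := Ck_mul (dhP k (ltnSn k) (CkS kf) kh) (Df v).
by apply: Ck_ext => x; rewrite (hd x v).2.
Qed.

Lemma Ck_exp V k (f : V -> R) : Ck k setT f -> Ck k setT (fun x => expR (f x)).
Proof. exact: (@Ck_comp _ k setT expR expR). Qed.

Lemma Ck_opp V k (f : V -> R) : Ck k setT f -> Ck k setT (fun x => - f x).
Proof.
move=> kf; apply: (@Ck_ext V R k setT (fun x => -1 * f x)).
  by move=> x; rewrite mulN1r.
by apply: Ck_mul => //; exact: Ck_const.
Qed.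

(** Each function is the derivative of the other up to sign, so the two inductions run together. *)
Lemma Ck_sin_cos V k (f : V -> R) : Ck k setT f ->
  Ck k setT (sin \o f) /\ Ck k setT (cos \o f).
Proof.
elim: k => [|k IH] kf.
  by split; [apply: (@Ck_comp _ 0 setT sin cos)|
             apply: (@Ck_comp _ 0 setT cos (fun x => - sin x))].
have [ks kc] := IH (CkS kf); have [df Df] := kf.
split; split.
- by move=> x _; have [] := derive_comp1 0 (df x I) (is_derive_sin (f x)).
- move=> v; apply: (Ck_ext _ (Ck_mul kc (Df v))) => x.
  by rewrite (derive_comp1 v (df x I) (is_derive_sin (f x))).2.
- by move=> x _; have [] := derive_comp1 0 (df x I) (is_derive_cos (f x)).
- move=> v; apply: (Ck_ext _ (Ck_mul (Ck_opp ks) (Df v))) => x.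
  by rewrite (derive_comp1 v (df x I) (is_derive_cos (f x))).2.
Qed.

Lemma is_derive_inv (y : R) : 0 < y ->
  is_derive y (1 : R) (fun y => y^-1) (- (y^-1 * y^-1)).
Proof.
move=> y0; have yn0 : y != 0 by rewrite gt_eqF.
split; first by apply: (@derivableV _ _ id).
by rewrite (@deriveV _ _ id)// derive_id /GRing.scale/= mulr1 expr2 invfM.
Qed.

Lemma Ck_inv V k (f : V -> R) :
  (forall x, 0 < f x) -> Ck k setT f -> Ck k setT (fun x => (f x)^-1).
Proof.
move=> f0; apply: (@Ck_comp _ k [set y | 0 < y] (fun y => y^-1) _ f) => //.
  by move=> y y0; exact: is_derive_inv.
by move=> j _ _ kj; apply: (@Ck_opp _ _ (fun x => (f x)^-1 * (f x)^-1)); exact: Ck_mul.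
Qed.

Lemma Ck_ln V k (f : V -> R) :
  (forall x, 0 < f x) -> Ck k setT f -> Ck k setT (fun x => ln (f x)).
Proof.
move=> f0; apply: (@Ck_comp _ k [set y | 0 < y] (@ln R) (fun y => y^-1)) => //.
by move=> j _ kf _; exact: Ck_inv.
Qed.

Lemma Ck_atan V k (f : V -> R) : Ck k setT f -> Ck k setT (fun x => atan (f x)).
Proof.
apply: (@Ck_comp _ k setT (@atan R) (fun y => (1 + y ^+ 2)^-1)) => // j _ kf _.
apply: (@Ck_inv _ _ (fun x => 1 + f x ^+ 2)).
  by move=> x; rewrite ltr_pwDl// sqr_ge0.
by apply: Ck_add; [exact: Ck_const|exact: Ck_mul].
Qed.

End Smoothness.

(** * Quotients of R^n by discrete groups of translations *)

Section FlatTopology.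
Variables (R : realType) (n : nat).

(* Asking that nonzero elements have norm at least 2 makes the unit balls of
   R^n embed in the quotient, so that they serve as charts.  The group need not
   have full rank: the zero group gives R^n itself. *)
Record lattice := Lattice {
  lattice_set :> 'rV[R]_n -> Prop;
  lattice0 : lattice_set 0;
  latticeB : forall u v, lattice_set u -> lattice_set v -> lattice_set (u - v);
  lattice_discrete : forall u, lattice_set u -> `|u| < 2 -> u = 0 }.

Variable G : lattice.

Lemma latticeN u : G u -> G (- u).
Proof. by rewrite -sub0r; apply: latticeB; exact: lattice0. Qed.

Lemma latticeD u v : G u -> G v -> G (u + v).
Proof. by move=> Gu Gv; rewrite -[v]opprK; apply: latticeB => //; exact: latticeN. Qed.

Definition congruent (u v : 'rV[R]_n) : bool := `[< G (u - v) >].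

Lemma congruent_equiv : equiv_class_of congruent.
Proof.
split=> [u|u v|v u w]; rewrite /congruent.
- by apply/asboolP; rewrite subrr; exact: lattice0.
- by apply/asboolP/asboolP => /latticeN; rewrite opprB.
- move=> /asboolP uv /asboolP vw; apply/asboolP.
  by rewrite -(subrKA v); exact: latticeD.
Qed.

Canonical congruent_equiv_rel := EquivRelPack congruent_equiv.

Definition flat_quot := {eq_quot congruent_equiv_rel}%qT.

Definition flat := quotient_topology flat_quot.

Definition flat_proj (v : 'rV[R]_n) : flat := (\pi_flat v)%qT.

Definition flat_repr (x : flat) : 'rV[R]_n := repr x.

Lemma flat_reprK x : flat_proj (flat_repr x) = x.
Proof. exact: reprK. Qed.

Lemma flat_projP u v : flat_proj u = flat_proj v <-> G (u - v).
Proof.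
split=> [/eqmodP /asboolP //|Guv].
by apply/eqmodP/asboolP.
Qed.

Lemma flat_projD u g : G g -> flat_proj (u + g) = flat_proj u.
Proof. by move=> Gg; apply/flat_projP; rewrite addrC addKr. Qed.

Lemma flat_proj_continuous : continuous flat_proj.
Proof. exact: pi_continuous. Qed.

(** The saturation of [A] is the union of its translates by elements of [G]. *)
Lemma flat_proj_open (A : set 'rV[R]_n) : open A -> open (flat_proj @` A).
Proof.
move=> oA; rewrite /open/= /quotient_open.
rewrite (_ : _ @^-1` _ = \bigcup_(g in G) [set v | A (v + g)]).
  apply: bigcup_open => g _.
  have /continuousP/(_ _ oA)// : continuous (fun v : 'rV[R]_n => v + g).
  by move=> v; exact: (@cvgD _ _ _ _ _ id (cst g) v g (@cvg_id _ (nbhs v)) (@cvg_cst _ g _ _ _)).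
apply/seteqP; split=> v /=.
  by move=> [w Aw /flat_projP wv]; exists (w - v) => //=; rewrite addrC subrK.
by move=> [g Gg Avg]; exists (v + g) => //; exact: flat_projD.
Qed.

Lemma flat_proj_nbhs v (A : set 'rV[R]_n) : nbhs v A -> nbhs (flat_proj v) (flat_proj @` A).
Proof.
rewrite nbhsE => -[B [oB Bv] BA].
apply: (@filterS _ _ _ (flat_proj @` B)); first by move=> _ [w Bw <-]; exists w => //; exact: BA.
by apply: open_nbhs_nbhs; split; [exact: flat_proj_open|exists v].
Qed.

(** Once an element [g] of [G] lies within 1 of [u], no other element can be closer to [u], since it
    would be less than 2 away from [g]. This is what separates points of the quotient. *)
Lemma lattice_separated u : ~ G u -> exists2 e, 0 < e & forall g, G g -> e <= `|u - g|.
Proof.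
move=> Gu.
have [[g [Gg ug]]|H] := pselect (exists g, G g /\ `|u - g| < 1); last first.
  by exists 1 => // g Gg; rewrite leNgt; apply/negP => ?; apply: H; exists g.
have ug0 : 0 < `|u - g|.
  by rewrite normr_gt0 subr_eq0; apply/eqP => ugE; apply: Gu; rewrite ugE.
exists `|u - g| => // h Gh; rewrite leNgt; apply/negP => hg.
have : h - g = 0.
  apply: (lattice_discrete (latticeB Gh Gg)).
  rewrite -(subrKA u); apply: le_lt_trans (ler_normD _ _) _.
  rewrite distrC (_ : 2 = 1 + 1)// ltrD//; exact: lt_trans ug.
by move=> /subr0_eq hE; rewrite hE ltxx in hg.
Qed.

Lemma flat_hausdorff : hausdorff_space flat.
Proof.
move=> x y; rewrite -(flat_reprK x) -(flat_reprK y); set u := flat_repr x; set v := flat_repr y.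
move=> cl; apply/flat_projP; apply: contrapT => /lattice_separated[e e0 He].
have e20 : 0 < e / 2 by rewrite divr_gt0.
have [z [[a au az] [b bv bz]]] := cl _ _ (flat_proj_nbhs (nbhsx_ballx u _ e20))
   (flat_proj_nbhs (nbhsx_ballx v _ e20)).
move: au bv; rewrite -!ball_normE/= => au bv.
have Gab : G (a - b) by apply/flat_projP; rewrite az bz.
have := He _ Gab; rewrite leNgt => /negP; apply.
rewrite (_ : u - v - (a - b) = (u - a) - (v - b)); last first.
  by apply/rowP => i; rewrite !mxE; ring.
by rewrite [e]splitr; apply: le_lt_trans (ler_normB _ _) _; rewrite ltrD.
Qed.

Lemma rV_rat_approx (v : 'rV[R]_n) e : 0 < e ->
  exists q : 'rV[rat]_n, `|v - map_mx ratr q| < e.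
Proof.
move=> e0.
have /choice[q Hq] : forall i : 'I_n, exists q : rat, `|v ord0 i - ratr q| < e.
  move=> i; have /rat_in_itvoo[q] : v ord0 i - e < v ord0 i + e.
    by rewrite ltrBlDr -addrA ltrDl addr_gt0.
  by rewrite in_itv/= => /andP[q1 q2]; exists q; rewrite ltr_norml; apply/andP; split; lra.
exists (\row_i q i).
have : ball v e (map_mx ratr (\row_i q i)).
  split=> // i j; rewrite ord1 !mxE; exact: Hq.
by rewrite -ball_normE.
Qed.

Lemma flat_second_countable : @second_countable flat.
Proof.
pose U (qk : 'rV[rat]_n * nat) : set flat :=
  flat_proj @` ball (map_mx ratr qk.1 : 'rV[R]_n) (qk.2.+1%:R^-1).
exists (range U); first exact: (sub_countable (card_image_le _ _) (countableP _)).
split=> [_ [qk _ <-]|x B].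
  exact/flat_proj_open/ball_open.
move=> Bx; have : nbhs (flat_repr x) (flat_proj @^-1` B).
  by apply: flat_proj_continuous; rewrite flat_reprK.
move=> /nbhs_ballP[e /= e0 eB].
have e20 : 0 < e / 2 by rewrite divr_gt0.
have [k /= ke] : exists k : nat, k.+1%:R^-1 < e / 2.
  exists (Num.truncn (e / 2)^-1).
  rewrite invf_plt ?posrE//.
  exact: truncnS_gt.
have k0 : 0 < k.+1%:R^-1 :> R by rewrite invr_gt0 ltr0n.
have [q qx] := rV_rat_approx (flat_repr x) k0.
exists (U (q, k)); first split; [by exists (q, k)| |].
- exists (flat_repr x); last exact: flat_reprK.
  by rewrite /= -ball_normE/= distrC.
- move=> _ [w + <-]; rewrite /= -ball_normE/= => qw; apply: eB.
  rewrite -ball_normE/= -(subrKA (map_mx ratr q)) [e]splitr.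
  by apply: le_lt_trans (ler_normD _ _) _; rewrite ltrD//; [exact: lt_trans ke|exact: lt_trans ke].
Qed.

(** [xget] selects the representative in the unit ball around the chosen lift of [p]; it is unique
    because two congruent points of that ball are less than 2 apart. Off the domain the value
    defaults to 0. *)
Definition flat_chart (p : flat) : chart R n flat :=
  Chart (flat_proj @` ball (flat_repr p) 1)
    (fun y => xget 0 [set w | ball (flat_repr p) 1 w /\ flat_proj w = y]) flat_proj.

Arguments flat_chart : simpl never.

Lemma flat_chart_proj p w : ball (flat_repr p) 1 w -> chart_map (flat_chart p) (flat_proj w) = w.
Proof.
move=> pw; rewrite /=; case: xgetP => [w' _ [pw' /flat_projP ww']|/(_ w)/=]; last first.
  by case; split.
apply/subr0_eq; apply: (lattice_discrete ww').
move: pw pw'; rewrite -ball_normE /= => pw pw'.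
rewrite -(subrKA (flat_repr p)) (_ : 2 = 1 + 1)//.
by apply: le_lt_trans (ler_normD _ _) _; rewrite ltrD// distrC.
Qed.

Lemma flat_chart_mapK p x : chart_dom (flat_chart p) x ->
  ball (flat_repr p) 1 (chart_map (flat_chart p) x) /\
  flat_proj (chart_map (flat_chart p) x) = x.
Proof. by move=> [w pw <-]; rewrite flat_chart_proj. Qed.

Lemma flat_chart_center x : chart_map (flat_chart x) x = flat_repr x.
Proof. by rewrite -{2}(flat_reprK x) flat_chart_proj//; exact: ballxx. Qed.

Lemma flat_chart_dom_center x : chart_dom (flat_chart x) x.
Proof. by exists (flat_repr x); [exact: ballxx|exact: flat_reprK]. Qed.

Lemma flat_chart_dom_open p : open (chart_dom (flat_chart p)).
Proof. exact/flat_proj_open/ball_open. Qed.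

Lemma flat_chart_img p : chart_img (flat_chart p) = ball (flat_repr p) 1.
Proof.
apply/seteqP; split=> w /=.
  by move=> [_ [v pv <-] <-]; rewrite flat_chart_proj.
by move=> pw; exists (flat_proj w); [exists w|exact: flat_chart_proj].
Qed.

Lemma flat_chart_continuous p x : chart_dom (flat_chart p) x ->
  {for x, continuous (chart_map (flat_chart p))}.
Proof.
move=> [w pw <-] A; rewrite flat_chart_proj// => wA.
have : nbhs w (A `&` ball (flat_repr p) 1).
  by apply: filterI => //; apply: open_nbhs_nbhs; split => //; exact: ball_open.
move=> /flat_proj_nbhs; apply: filterS => _ [v [Av pv] <-].
by move: Av; rewrite -{1}(flat_chart_proj pv).
Qed.

(** An element of [G] carries [h t] into the unit ball on which the chart lives, and by continuity
    the same element works for all nearby arguments. Hence chart expressions are locally lifts plus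
    constants. *)
Lemma flat_chart_near (T : topologicalType) (h : T -> 'rV[R]_n) (t : T) p :
  {for t, continuous h} -> chart_dom (flat_chart p) (flat_proj (h t)) ->
  exists2 g, G g & \near t, chart_map (flat_chart p) (flat_proj (h t)) = h t + g.
Proof.
move=> ch [w pw wE].
have /flat_projP Gg := wE; exists (w - h t) => //.
have : nbhs (h t + (w - h t)) (ball (flat_repr p) 1).
  by rewrite addrC subrK; apply: open_nbhs_nbhs; split => //; exact: ball_open.
have : {for t, continuous (fun t' => h t' + (w - h t))}.
  exact: (@cvgD _ _ _ _ _ h (cst (w - h t)) _ _ ch (@cvg_cst _ _ _ _ _)).
move=> /[apply] H; near=> s.
rewrite -(flat_projD (h s) Gg) flat_chart_proj//.
by near: s; exact: H.
Unshelve. all: by end_near. Qed.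

Lemma flat_is_chart p : is_chart (flat_chart p).
Proof.
split.
- exact: flat_chart_dom_open.
- by rewrite flat_chart_img; exact: ball_open.
- by apply: continuous_in_subspaceT => x /[!inE]; exact: flat_chart_continuous.
- exact/continuous_subspaceT/flat_proj_continuous.
- by move=> x /flat_chart_mapK[].
Qed.

End FlatTopology.

Arguments flat_chart {R n G} : simpl never.

Section FlatMaps.
Variable R : realType.

Lemma smooth_chart_flat m n (G : lattice R n) (h : 'rV[R]_m -> 'rV[R]_n) p
    (U : set 'rV[R]_m) (f : 'rV[R]_m -> 'rV[R]_n) :
  smooth_on setT h ->
  (forall w, U w -> chart_dom (flat_chart p) (flat_proj G (h w))) ->
  (forall w, f w = chart_map (flat_chart p) (flat_proj G (h w))) ->
  smooth_on U f.
Proof.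
move=> sh hU fE k; apply: Ck_near => w /hU hw.
have [|g _ gh] := flat_chart_near (h := h) (t := w) _ hw.
  by have := sh 0 => /(_ w I).
exists (fun w => h w + g); split.
  by apply: filterS gh => y <-; exact: fE.
exact: (Ck_add (sh k) (Ck_const k setT g)).
Qed.

Lemma smooth_id n : smooth_on setT (@id 'rV[R]_n).
Proof. by move=> k; apply: Ck_row => i; exact: Ck_coord. Qed.

Lemma flat_smooth_atlas n (G : lattice R n) : is_smooth_atlas (@flat_chart R n G).
Proof.
split=> [p|p|p q]; [exact: flat_is_chart|exact: flat_chart_dom_center|].
apply: (@smooth_chart_flat _ _ G id q); [exact: smooth_id| |by []].
by move=> w [x [px qx] <-] /=; have [_ ->] := flat_chart_mapK px.
Qed.

Definition flat_manifold n (G : lattice R n) : manifold R n :=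
  Manifold (@flat_hausdorff R n G) (@flat_second_countable R n G)
    (flat_smooth_atlas G).

Lemma flat_smooth_map m n (G : lattice R m) (H : lattice R n)
    (h : 'rV[R]_m -> 'rV[R]_n) (f : flat G -> flat H) :
  smooth_on setT h -> (forall w, f (flat_proj G w) = flat_proj H (h w)) ->
  smooth_map (@flat_chart R m G) (@flat_chart R n H) f.
Proof.
move=> sh fh; split=> [|p q].
  apply: continuous_subspaceT; apply/quotient_continuous => w.
  rewrite (_ : f \o _ = flat_proj H \o h); last by apply/funext => v; exact: fh.
  by apply: continuous_comp; [exact: (sh 0)|exact: flat_proj_continuous].
apply: (@smooth_chart_flat _ _ H h q) => //.
  by move=> _ [x [[_ px] qx] <-] /=; rewrite -fh; have [_ ->] := flat_chart_mapK px.
by move=> w /=; rewrite fh.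
Qed.

(* The base point [w0] may be any representative of the class of [w]: the chart
   expression of [f] is invariant under translations by [G]. *)
Lemma flat_chart_derive m n (G : lattice R m) (H : lattice R n) p (w0 w : 'rV[R]_m)
    (h : 'rV[R]_m -> 'rV[R]_n) (f : flat G -> flat H) :
  smooth_on setT h -> (forall w, f (flat_proj G w) = flat_proj H (h w)) ->
  chart_dom (flat_chart p) (f (flat_proj G w)) -> flat_proj G w0 = flat_proj G w ->
  linfun ('d (chart_map (flat_chart p) \o f \o flat_proj G) w0) =1 derive h w.
Proof.
move=> sh fh pw w0w v; rewrite lfunE/=.
set d := w - w0.
have wE : w0 + d = w by rewrite /d addrC subrK.
have Gd : G d by apply/flat_projP.
have dh y : differentiable h y by have [+ _] := sh 1; exact.
(* Precomposing with the translation by [d] moves the base point from [w0] to [w]; the projected map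
   does not change, as [d] lies in [G]. *)
pose tr (y : 'rV[R]_m) : 'rV[R]_m := y + d.
have dtr : is_diff w0 tr (id + 0) by exact: is_diffD.
have dhd : differentiable (h \o tr) w0.
  by apply: differentiable_comp; [exact: ex_diff|exact: dh].
have [||g _ Hg] := @flat_chart_near _ _ H _ (h \o tr) w0 p.
- exact: differentiable_continuous.
- by rewrite /= /tr wE -fh.
have [||_ ->] := @near_eq_diff R _ _ (chart_map (flat_chart p) \o f \o flat_proj G)
   ((h \o tr) + cst g) w0.
- by apply: filterS Hg => y E; rewrite -[RHS]E /= -fh flat_projD.
- by apply: differentiableD => //; exact: differentiable_cst.
have E1 := congr1 (fun F => F v) (diffD dhd (differentiable_cst g w0)).
have E2 := congr1 (fun F => F v) (diff_comp (ex_diff (is_diff_def := dtr)) (dh (tr w0))).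
have E3 := congr1 (fun F => F v) (diff_cst g w0 : _ = (0 : 'rV[R]_m -> 'rV[R]_n)).
have E4 := congr1 (fun F => F v) (diff_val (is_diff_def := dtr)).
apply: (etrans E1); apply: (etrans (congr2 _ E2 E3)).
rewrite addr0 [LHS]/=; apply: (etrans (congr1 _ E4)).
by rewrite /= addr0 [tr w0]wE deriveE.
Qed.

Lemma flat_chartsE n (G : lattice R n) (x : flat_manifold G) :
  charts x = flat_chart x.
Proof. by []. Qed.

Lemma flat_tangent_map m n (G : lattice R m) (H : lattice R n)
    (h : 'rV[R]_m -> 'rV[R]_n) (f : flat G -> flat H) w x v :
  smooth_on setT h -> (forall w, f (flat_proj G w) = flat_proj H (h w)) ->
  flat_proj G w = x ->
  tangent_map (M := flat_manifold G) (N := flat_manifold H) f x v = derive h w v.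
Proof.
move=> sh fh <-; rewrite /tangent_map !flat_chartsE flat_chart_center.
apply: flat_chart_derive => //; first exact: flat_chart_dom_center.
exact: flat_reprK.
Qed.

Lemma flat_tangent_coord n (G : lattice R n) p x v :
  chart_dom (flat_chart p) x ->
  tangent_coord (M := flat_manifold G) p x v = v.
Proof.
move=> px; rewrite /tangent_coord !flat_chartsE flat_chart_center.
rewrite (@flat_chart_derive _ _ G G p _ (flat_repr x) id id)//.
- exact: derive_id.
- exact: smooth_id.
- by rewrite flat_reprK.
Qed.

Lemma flat_tangent_of_coord n (G : lattice R n) p x v :
  chart_dom (flat_chart p) x ->
  tangent_of_coord (M := flat_manifold G) p x v = v.
Proof.
move=> px; rewrite /tangent_of_coord !flat_chartsE.
have [_ pE] := flat_chart_mapK px.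
rewrite (@flat_chart_derive _ _ G G x _ (flat_repr x) id id)//.
- exact: derive_id.
- exact: smooth_id.
- by rewrite flat_reprK; exact: flat_chart_dom_center.
- by rewrite flat_reprK.
Qed.

Lemma ball_chart_near n (G : lattice R n) (p : flat G) w : chart_img (flat_chart p) w ->
  \near w, chart_dom (flat_chart p) (flat_proj G w).
Proof.
rewrite flat_chart_img => pw.
have : nbhs w (ball (flat_repr p) 1) by apply: open_nbhs_nbhs; split => //; exact: ball_open.
by apply: filterS => v pv; exists v.
Qed.

(** Coordinate changes are local translations, so the constant form looks the same in every
    chart. *)
Lemma flat_metric n (G : lattice R n) :
  is_metric (M := flat_manifold G) (fun=> 1%:M).
Proof.
split=> [x|x v v0|p u v k]; first exact: trmx1.
- rewrite /bilin mulmx1 mxE.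
  under eq_bigr do rewrite mxE.
  rewrite lt_def; apply/andP; split; last by apply: sumr_ge0 => i _; rewrite sqr_ge0.
  apply: contraNneq v0 => /psumr_eq0P H; apply/eqP/rowP => i; rewrite mxE.
  have /eqP := H (fun i _ => sqr_ge0 _) i isT.
  by rewrite mulf_eq0 => /orP[] /eqP.
- apply: Ck_near => w pw; exists (cst (bilin 1%:M u v)); split; last exact: Ck_const.
  have := ball_chart_near pw; apply: filterS => y py /=.
  by rewrite !flat_tangent_of_coord.
Qed.

Definition flat_riemannian n (G : lattice R n) : riemannian R n :=
  Riemannian (flat_metric G).

Lemma flat_smooth_vector_field n (G : lattice R n) (X : flat G -> 'rV[R]_n)
    (Y : 'rV[R]_n -> 'rV[R]_n) :
  smooth_on setT Y -> (forall w, X (flat_proj G w) = Y w) ->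
  smooth_vector_field (M := flat_manifold G) X.
Proof.
move=> sY XY p k; apply: Ck_near => w pw; exists Y; split=> //.
have := ball_chart_near pw; apply: filterS => y py /=.
by rewrite flat_tangent_coord.
Qed.

Lemma continuous_row (T : topologicalType) n (f : T -> 'rV[R]_n) t :
  (forall i, {for t, continuous (fun x => f x ord0 i)}) -> {for t, continuous f}.
Proof.
move=> cf.
rewrite /prop_for /continuous_at => A [P fP PA].
have H : \near t, forall i, P ord0 i (f t ord0 i).
  by apply: filter_forall => i; apply: cf; exact: fP.
by apply: filterS H => x fx; apply: PA => i j; rewrite ord1.
Qed.

Lemma continuous_row_mx (T : topologicalType) n (f : T -> 'rV[R]_n) (s : T -> R) t :
  {for t, continuous f} -> {for t, continuous s} ->
  {for t, continuous (fun x => row_mx (f x) (s x)%:M : 'rV[R]_(n + 1))}.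
Proof.
move=> cf cs; apply: continuous_row => i.
case: (split_ordP i) => j ->.
  rewrite (_ : (fun _ => _) = (fun x => f x ord0 j)).
    exact: (continuous_comp cf (@coord_continuous _ _ _ _ _ _)).
  by apply/funext => x; rewrite row_mxEl.
rewrite (_ : (fun _ => _) = s)//.
by apply/funext => x; rewrite row_mxEr !ord1 mxE mulr1n.
Qed.

Lemma flat_smooth_map_prod m n (G : lattice R m) (H : lattice R n)
    (h : 'rV[R]_(m + 1) -> 'rV[R]_n) (f : flat G * R -> flat H) :
  smooth_on setT h ->
  (forall w s, f (flat_proj G w, s) = flat_proj H (h (row_mx w s%:M))) ->
  smooth_map (prod_atlas (@flat_chart R m G)) (@flat_chart R n H) f.
Proof.
move=> sh fh; split=> [|p q].
  apply: continuous_subspaceT => -[x s].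
  (* The source is a product and not itself presented as a quotient, so continuity is checked near
     [(x, s)] by factoring [f] through the chart at [x] and the lift [h]. *)
  pose k (z : flat G * R) : 'rV[R]_(m + 1) :=
    row_mx (chart_map (flat_chart x) z.1) z.2%:M.
  have cs : {for (x, s), continuous (snd : flat G * R -> R)} by exact: cvg_snd.
  have ck : {for (x, s), continuous k}.
    apply: continuous_row_mx => //.
    apply: (@continuous_comp _ _ _ fst (chart_map (flat_chart x))); first exact: cvg_fst.
    exact/flat_chart_continuous/flat_chart_dom_center.
  have chk : {for (x, s), continuous (flat_proj H \o (h \o k))}.
    apply: continuous_comp; last exact: flat_proj_continuous.
    by apply: continuous_comp => //; exact: (sh 0).
  have kE : \forall z \near (x, s), (flat_proj H \o (h \o k)) z = f z.
    have : nbhs x (chart_dom (flat_chart x)).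
      apply: open_nbhs_nbhs; split; first exact: flat_chart_dom_open.
      exact: flat_chart_dom_center.
    have cf : {for (x, s), continuous (fst : flat G * R -> flat G)} by exact: cvg_fst.
    move=> /cf H1; have H2 : \forall z \near (x, s), chart_dom (flat_chart x) z.1 by exact: H1.
    near=> z.
    have /flat_chart_mapK[_ zE] : chart_dom (flat_chart x) z.1 by near: z; exact: H2.
    rewrite /= /k -fh zE; by case: (z).
  rewrite /continuous_at -(nbhs_singleton kE).
  exact: cvg_trans (near_eq_cvg kE) chk.
apply: (@smooth_chart_flat _ _ H h (q)) => //.
  move=> _ [[x s] [[_ [px _]] qx] <-] /=.
  rewrite -fh; have [_ ->] := flat_chart_mapK px; exact: qx.
move=> w; have fw : f (flat_proj G (lsubmx w), rsubmx w ord0 ord0) = flat_proj H (h w).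
  rewrite fh; congr (flat_proj H (h _)); rewrite -[RHS]hsubmxK; congr row_mx.
  by apply/rowP => i; rewrite !ord1 mxE mulr1n.
by rewrite -fw.
Unshelve. all: by end_near. Qed.

End FlatMaps.

(** * The flow of diag(1, exp(-t)) on directions *)

Section AngleFlow.
Variable R : realType.
Implicit Types s t a b : R.

(* [(cos a, expR (- t) * sin a)] is the image of the unit vector of angle [a]
   by [diag(1, exp(-t))]; [rho2 t a] is its squared length, [ang t a] the choice
   of its angle within pi/2 of [a], and [stretch t a] the log of its length. *)
Definition rho2 t a : R := cos a ^+ 2 + expR (- t) ^+ 2 * sin a ^+ 2.

Definition ang t a : R :=
  a + atan ((expR (- t) - 1) * (sin a * cos a) / (cos a ^+ 2 + expR (- t) * sin a ^+ 2)).

Definition stretch t a : R := ln (rho2 t a) / 2.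

Lemma sumsq_gt0 a (k : R) : 0 < k -> 0 < cos a ^+ 2 + k * sin a ^+ 2.
Proof.
move=> k0; have := cos2Dsin2 a; have := sqr_ge0 (cos a); have := sqr_ge0 (sin a).
have [->|s0] := eqVneq (sin a ^+ 2) 0; first by move=> _ _; rewrite addr0 mulr0 addr0 => ->.
move=> s1 c1 _; apply: ltr_wpDl => //; apply: mulr_gt0 => //.
by rewrite lt_def s0.
Qed.

Lemma rho2_gt0 t a : 0 < rho2 t a.
Proof. by apply: sumsq_gt0; rewrite exprn_gt0// expR_gt0. Qed.

(** Justifies the formula of [ang]. For the unit vector of angle [a] and its image, the cross
    product is [(k - 1) * (sin a * cos a)] and the inner product is [D], which is positive; so the
    arctangent of their quotient is the oriented angle between the two. *)
Lemma cos_sin_ang t a :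
  cos (ang t a) = cos a / Num.sqrt (rho2 t a) /\
  sin (ang t a) = expR (- t) * sin a / Num.sqrt (rho2 t a).
Proof.
set k := expR (- t); have k0 : 0 < k by exact: expR_gt0.
set D := cos a ^+ 2 + k * sin a ^+ 2; have D0 : 0 < D by exact: sumsq_gt0.
set u := (k - 1) * (sin a * cos a) / D.
set r := Num.sqrt (rho2 t a).
have r0 : 0 < r by rewrite sqrtr_gt0 rho2_gt0.
have rE : r ^+ 2 = cos a ^+ 2 + k ^+ 2 * sin a ^+ 2.
  by rewrite sqr_sqrtr// ltW// rho2_gt0.
have cs := cos2sin2 a.
have Dn0 : D != 0 by rewrite gt_eqF.
have rn0 : r != 0 by rewrite gt_eqF.
have uE : Num.sqrt (1 + u ^+ 2) = r / D.
  (* Cross product squared plus inner product squared equals the squared length [r ^+ 2] of the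
     image. *)
  have -> : 1 + u ^+ 2 = (r / D) ^+ 2.
    rewrite [RHS]expr_div_n rE /u expr_div_n; apply: (mulIf (expf_neq0 2 Dn0)).
    by rewrite mulrDl !divfK ?expf_neq0// /D; ring: cs.
  by rewrite sqrtr_sqr ger0_norm// divr_ge0// ltW.
have ca : cos (atan u) = D / r by rewrite cos_atan uE invf_div.
have ct0 : cos (atan u) != 0 by rewrite ca mulf_neq0 ?invr_neq0.
have sa : sin (atan u) = (k - 1) * (sin a * cos a) / r.
  rewrite -[LHS](divfK ct0) -/(tan _) atanK ca /u; field; exact/andP.
split; rewrite /ang -/k -/D -/u ?cosD ?sinD ca sa.
  apply: (mulIf rn0); rewrite divfK// mulrBl; rewrite /D.
  rewrite !mulrA !divfK//; ring: cs.
apply: (mulIf rn0); rewrite divfK// mulrDl /D.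
rewrite !mulrA !divfK//; ring: cs.
Qed.

Lemma angB t a : `|ang t a - a| < pi / 2.
Proof. by rewrite /ang addrC addKr ltr_norml atan_gtNpi2 atan_ltpi2. Qed.

(** Otherwise half the difference has absolute value strictly between 0 and pi, where the sine is
    nonzero, while equal cosines and sines force its squared cosine to be 1. *)
Lemma cos_sin_eq a b : cos a = cos b -> sin a = sin b -> `|a - b| < pi *+ 2 -> a = b.
Proof.
move=> cab sab ab; apply/subr0_eq/eqP/negPn/negP => x0.
set x := a - b in ab x0.
have y0 : 0 < `|x| / 2 < pi.
  by rewrite divr_gt0 ?normr_gt0//= ltr_pdivrMr// mulr_natr.
have sp := sin_gt0_pi y0.
have : cos x = 1 by rewrite cosB cab sab -!expr2 cos2Dsin2.
rewrite -cos_norm (_ : `|x| = (`|x| / 2) *+ 2); last by rewrite -mulr_natr divfK.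
rewrite cos_mulr2n mulr2n => c2.
have {}c2 : cos (`|x| / 2) ^+ 2 = 1 by lra.
by have := sin2cos2 (`|x| / 2); rewrite c2 subrr => /eqP; rewrite sqrf_eq0 gt_eqF.
Qed.

(** The displacement depends on the direction only, which lets the flow pass to the quotient by full
    turns. *)
Lemma ang_rotate t a b : cos a = cos b -> sin a = sin b -> ang t a - a = ang t b - b.
Proof. by move=> cab sab; rewrite /ang cab sab ![_ + atan _]addrC !addrK. Qed.

Lemma stretch_rotate t a b : cos a = cos b -> sin a = sin b -> stretch t a = stretch t b.
Proof. by rewrite /stretch /rho2 => -> ->. Qed.

Lemma cos_sin_period a (m : int) :
  cos (a + (pi *+ 2) *~ m) = cos a /\ sin (a + (pi *+ 2) *~ m) = sin a.
Proof.
have H (j : nat) b : cos (b + (pi *+ 2) *+ j) = cos b /\ sin (b + (pi *+ 2) *+ j) = sin b.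
  by rewrite (periodicn (@cosD2pi R)) (periodicn (@sinD2pi R)).
case: m => j; first exact: H.
rewrite NegzE mulrNz; have [] := H j.+1 (a + - (pi *+ 2) *~ j.+1%:Z).
by rewrite -addrA mulNrz pmulrn addNr addr0.
Qed.

(** Cocycle rule for squared lengths: the unit vector of angle [ang t a] is the image at time [t]
    divided by its length. Its logarithm makes [stretch] additive along orbits. *)
Lemma rho2_ang s t a : rho2 s (ang t a) = rho2 (s + t) a / rho2 t a.
Proof.
rewrite [rho2 s _]/rho2 [rho2 (s + t) a]/rho2; have [-> ->] := cos_sin_ang t a.
rewrite !expr_div_n !sqr_sqrtr ?(ltW (rho2_gt0 _ _))// opprD expRD.
have := rho2_gt0 t a; set r := rho2 t a => r0.
by field; rewrite gt_eqF.
Qed.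

(** Both sides are angles of the same vector, so they agree modulo 2 pi. Three displacements, each
    below pi/2, bound their difference by 3 pi/2, which rules out a full turn. *)
Lemma angD s t a : ang (s + t) a = ang s (ang t a).
Proof.
have [c1 s1] := cos_sin_ang (s + t) a; have [c2 s2] := cos_sin_ang s (ang t a).
have [c3 s3] := cos_sin_ang t a.
have r1 := rho2_gt0 t a; have r2 := rho2_gt0 (s + t) a.
have sr1 : Num.sqrt (rho2 t a) != 0 by rewrite gt_eqF// sqrtr_gt0.
have sr2 : Num.sqrt (rho2 (s + t) a) != 0 by rewrite gt_eqF// sqrtr_gt0.
apply: cos_sin_eq.
- rewrite c1 c2 rho2_ang c3 sqrtrM ?ltW// sqrtrV ?ltW//; field; exact/andP.
- rewrite s1 s2 rho2_ang s3 sqrtrM ?ltW// sqrtrV ?ltW// opprD expRD; field; exact/andP.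
- rewrite (_ : _ - _ = (ang (s + t) a - a) - (ang s (ang t a) - ang t a) - (ang t a - a)).
    have := angB (s + t) a; have := angB s (ang t a); have := angB t a.
    have := @pi_gt0 R; rewrite !ltr_norml -[pi *+ 2]mulr_natr => p0 /andP[? ?] /andP[? ?] /andP[? ?].
    by apply/andP; split; lra.
  by ring.
Qed.

Lemma ang0t a : ang 0 a = a.
Proof. by rewrite /ang oppr0 expR0 subrr !mul0r atan0 addr0. Qed.

Lemma stretch0t a : stretch 0 a = 0.
Proof. by rewrite /stretch /rho2 oppr0 expR0 expr1n mul1r cos2Dsin2 ln1 mul0r. Qed.

Lemma stretchD s t a : stretch (s + t) a = stretch t a + stretch s (ang t a).
Proof.
rewrite /stretch rho2_ang ln_div ?posrE ?rho2_gt0//; by field.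
Qed.

(** * Derivatives of the angle and of the stretch *)

Section RealDerivatives.
Variables (f g : R -> R) (a df dg : R).
Hypotheses (fa : is_derive a (1 : R) f df) (ga : is_derive a (1 : R) g dg).

Lemma is_derive_add : is_derive a (1 : R) (fun x => f x + g x) (df + dg).
Proof. exact: is_deriveD. Qed.

Lemma is_derive_mul : is_derive a (1 : R) (fun x => f x * g x) (df * g a + f a * dg).
Proof.
apply: (is_derive_eq (is_deriveM fa ga)).
by rewrite /GRing.scale/= addrC [g a * _]mulrC.
Qed.

Lemma is_derive_chain (h : R -> R) (dh : R) : is_derive (f a) (1 : R) h dh ->
  is_derive a (1 : R) (fun x => h (f x)) (dh * df).
Proof.
move=> hf; have [df1 df2] := fa.
have [D1 D2] := derive_comp1 (1 : R) ((derivable1_diffP _ _).1 df1) hf.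
by split; [exact/derivable1_diffP|rewrite D2 df2].
Qed.

End RealDerivatives.

Lemma is_derive_sumsq (k a : R) :
  is_derive a (1 : R) (fun b => cos b ^+ 2 + k * sin b ^+ 2)
    (2 * (k - 1) * (sin a * cos a)).
Proof.
have c := is_derive_cos a; have s := is_derive_sin a.
have := is_derive_add (is_derive_mul c c) (is_derive_mul (is_derive_cst k a 1) (is_derive_mul s s)).
by move=> /is_derive_eq; apply; rewrite /cst; ring.
Qed.

(** For a linear map of the plane acting on directions, the derivative is the determinant, here
    exp(-t), over the squared length of the image of the unit vector. *)
Lemma is_derive_ang t a : is_derive a (1 : R) (ang t) (expR (- t) / rho2 t a).
Proof.
set k := expR (- t); have k0 : 0 < k by exact: expR_gt0.
pose D b := cos b ^+ 2 + k * sin b ^+ 2.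
have D0 : 0 < D a by exact: sumsq_gt0.
have c := is_derive_cos a; have s := is_derive_sin a.
have dD : is_derive a (1 : R) D _ := is_derive_sumsq k a.
have dV := is_derive_chain dD (is_derive_inv D0).
have dn := is_derive_mul (is_derive_cst (k - 1) a 1) (is_derive_mul s c).
have du := is_derive_mul dn dV.
have := is_derive_add (is_derive_id a 1) (is_derive_chain du (is_derive1_atan _)).
move=> /is_derive_eq; apply; rewrite /cst /rho2 -/k.
have Dn0 : D a != 0 by rewrite gt_eqF.
have r0 := rho2_gt0 t a; rewrite /rho2 -/k in r0.
have cs := cos2sin2 a.
have E : 1 + ((k - 1) * (sin a * cos a) / D a) ^+ 2 =
  (cos a ^+ 2 + k ^+ 2 * sin a ^+ 2) / D a ^+ 2.
  rewrite expr_div_n; apply: (mulIf (expf_neq0 2 Dn0)).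
  by rewrite mulrDl !divfK ?expf_neq0// /D; ring: cs.
rewrite E; have rn0 : cos a ^+ 2 + k ^+ 2 * sin a ^+ 2 != 0 by rewrite gt_eqF.
apply: (mulIf rn0); rewrite [RHS]divfK//.
transitivity (cos a ^+ 2 + k ^+ 2 * sin a ^+ 2 + (k - 1) * (cos a ^+ 2 - sin a ^+ 2) * D a
   - 2 * (k - 1) ^+ 2 * (sin a * cos a) ^+ 2); last by rewrite /D; ring: cs.
by move: rn0; set r := _ + k ^+ 2 * _ => rn0; field; rewrite Dn0 rn0.
Qed.

Lemma is_derive_stretch t a : is_derive a (1 : R) (stretch t)
  ((expR (- t) ^+ 2 - 1) * (sin a * cos a) / rho2 t a).
Proof.
have r0 := rho2_gt0 t a.
have := is_derive_mul (is_derive_chain (is_derive_sumsq (expR (- t) ^+ 2) a) (is_derive1_ln r0))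
  (is_derive_cst (2^-1 : R) a 1).
move=> /is_derive_eq; apply; rewrite /cst; field; rewrite gt_eqF//.
Qed.

(** By the group law the orbit restarts from [b] at time [t], so only the derivative at elapsed time
    0 is needed; there the argument of the arctangent vanishes and its denominator is 1. *)
Lemma is_derive_ang_time t a :
  is_derive t (1 : R) (ang ^~ a) (- (sin (ang t a) * cos (ang t a))).
Proof.
set b := ang t a; set p := sin b * cos b.
pose h (s : R) := expR (- (s - t)).
have h1 : h t = 1 by rewrite /h subrr oppr0 expR0.
have dh : is_derive t (1 : R) h (- 1).
  have d1 : is_derive t (1 : R) (fun s => - (s - t)) (-1).
    have := is_deriveN (is_deriveB (is_derive_id t 1) (is_derive_cst t t 1)).
    by rewrite subr0.
  by have := is_derive_chain d1 (is_derive_expR _); rewrite subrr oppr0 expR0 mul1r.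
pose D s := cos b ^+ 2 + h s * sin b ^+ 2.
have Dt : D t = 1 by rewrite /D h1 mul1r cos2Dsin2.
have dD : is_derive t (1 : R) D (- sin b ^+ 2).
  have := is_derive_add (is_derive_cst (cos b ^+ 2) t 1)
    (is_derive_mul dh (is_derive_cst (sin b ^+ 2) t 1)).
  by move=> /is_derive_eq; apply; rewrite /cst; ring.
have Dt0 : 0 < D t by rewrite Dt.
have dV := is_derive_chain dD (is_derive_inv Dt0).
have dn := is_derive_mul (is_derive_add dh (is_derive_cst (- 1 : R) t 1))
  (is_derive_cst p t 1).
have := is_derive_add (is_derive_cst b t 1)
  (is_derive_chain (is_derive_mul dn dV) (is_derive1_atan _)).
move=> /is_derive_eq H; have {}H := H (- p).
have : is_derive t (1 : R) (fun s => b + atan ((h s + - 1) * p / D s)) (- p).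
  by apply: H; rewrite /cst h1 Dt subrr !mul0r expr0n/= !addr0 !invr1; ring.
congr is_derive; apply/funext => s.
by rewrite -[in RHS](subrK t s) angD.
Qed.

Lemma Ck_rho2 (V : normedModType R) k (f g : V -> R) :
  Ck k setT f -> Ck k setT g -> Ck k setT (fun x => rho2 (f x) (g x)).
Proof.
move=> kf kg; have [ks kc] := Ck_sin_cos kg; have ke := Ck_exp (Ck_opp kf).
apply: Ck_add; first exact: (Ck_mul kc kc).
exact: (Ck_mul (Ck_mul ke ke) (Ck_mul ks ks)).
Qed.

Lemma Ck_ang (V : normedModType R) k (f g : V -> R) :
  Ck k setT f -> Ck k setT g -> Ck k setT (fun x => ang (f x) (g x)).
Proof.
move=> kf kg; have [ks kc] := Ck_sin_cos kg; have ke := Ck_exp (Ck_opp kf).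
apply: Ck_add => //; apply: Ck_atan; apply: Ck_mul.
  apply: Ck_mul; last exact: Ck_mul.
  by apply: Ck_add => //; exact: Ck_const.
apply: Ck_inv; first by move=> x; apply: sumsq_gt0; exact: expR_gt0.
apply: Ck_add; first exact: (Ck_mul kc kc).
exact: (Ck_mul ke (Ck_mul ks ks)).
Qed.

Lemma Ck_stretch (V : normedModType R) k (f g : V -> R) :
  Ck k setT f -> Ck k setT g -> Ck k setT (fun x => stretch (f x) (g x)).
Proof.
move=> kf kg; apply: Ck_mul; last exact: Ck_const.
by apply: Ck_ln; [move=> x; exact: rho2_gt0|exact: Ck_rho2].
Qed.

(** In forward time the linear map lengthens no vector. The area estimate of the first example
    divides by this quantity. *)
Lemma rho2_le1 t a : 0 <= t -> rho2 t a <= 1.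
Proof.
move=> t0; rewrite -(cos2Dsin2 a) lerD2l ler_piMl ?sqr_ge0//.
by rewrite expr_le1// ?expR_ge0// expR_le1 oppr_le0.
Qed.

(** A positive diagonal map keeps cosine and sine nonnegative. Since the angle moves by less than
    pi/2, it stays between -pi/2 and pi, where these signs leave only the first quadrant. *)
Lemma ang_quadrant t a : 0 <= a <= pi / 2 -> 0 <= ang t a <= pi / 2.
Proof.
move=> /andP[a0 api].
have p0 := @pi_gt0 R.
have ca : 0 <= cos a by apply: cos_ge0_pihalf; apply/andP; split; lra.
have sa : 0 <= sin a by apply: sin_ge0_pi; apply/andP; split; lra.
have [cb sb] := cos_sin_ang t a.
have {cb}cb : 0 <= cos (ang t a) by rewrite cb divr_ge0// sqrtr_ge0.
have {sb}sb : 0 <= sin (ang t a) by rewrite sb divr_ge0 ?mulr_ge0 ?expR_ge0// sqrtr_ge0.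
have := angB t a; rewrite ltr_norml => /andP[l1 l2].
rewrite !leNgt; apply/andP; split; apply/negP => H.
  have : 0 < sin (- ang t a) by apply: sin_gt0_pi; apply/andP; split; lra.
  by rewrite sinN; lra.
have : 0 < cos (ang t a - pi) by apply: cos_gt0_pihalf; apply/andP; split; lra.
by rewrite -cosN opprB cosB cospi sinpi; lra.
Qed.

Lemma ang0 t : ang t 0 = 0.
Proof. by rewrite /ang sin0 !mul0r mulr0 mul0r atan0 addr0. Qed.

Lemma stretch0 t : stretch t 0 = 0.
Proof. by rewrite /stretch /rho2 sin0 cos0 expr1n expr0n mulr0 addr0 ln1 mul0r. Qed.

Lemma ang_pihalf t : ang t (pi / 2) = pi / 2.
Proof. by rewrite /ang cos_pihalf !mulr0 mul0r atan0 addr0. Qed.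

Lemma stretch_pihalf t : stretch t (pi / 2) = - t.
Proof.
rewrite /stretch /rho2 cos_pihalf sin_pihalf expr0n/= add0r expr1n mulr1.
by rewrite lnXn ?expR_gt0// expRK mulr2n; field.
Qed.

End AngleFlow.

(** * Derivatives and operator norms on flat quotients *)

Section Flat.
Variable R : realType.

Definition descend m n (G : lattice R m) (H : lattice R n)
    (h : 'rV[R]_m -> 'rV[R]_n) (x : flat G) : flat H := flat_proj H (h (flat_repr x)).

Definition equivariant m n (G : lattice R m) (H : lattice R n)
    (h : 'rV[R]_m -> 'rV[R]_n) := forall u g, G g -> H (h (u + g) - h u).

Lemma descendE m n (G : lattice R m) (H : lattice R n) (h : 'rV[R]_m -> 'rV[R]_n) w :
  equivariant G H h -> descend H h (flat_proj G w) = flat_proj H (h w).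
Proof.
move=> eh; apply/flat_projP; set u := flat_repr _.
have Gd : G (u - w) by apply/flat_projP; exact: flat_reprK.
by have := eh w _ Gd; rewrite [w + _]addrC subrK.
Qed.

Lemma derive_coord m n (h : 'rV[R]_m -> 'rV[R]_n) w v j :
  smooth_on setT h -> derive h w v ord0 j = derive (fun w => h w ord0 j) w v.
Proof.
move=> sh; rewrite derive_mx ?mxE//.
by apply: diff_derivable; have [+ _] := sh 1; exact.
Qed.

Lemma derive_comp_coord m (f : R -> R) df (w v : 'rV[R]_m) i :
  is_derive (w ord0 i) (1 : R) f df ->
  derivable (fun w : 'rV[R]_m => f (w ord0 i)) w v /\
  derive (fun w : 'rV[R]_m => f (w ord0 i)) w v = df * v ord0 i.
Proof.
move=> fd.
have [D1 D2] := derive_comp1 v (@differentiable_coord _ _ _ w ord0 i) fd.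
split; first exact: diff_derivable.
rewrite D2; congr (_ * _).
rewrite deriveE; last exact: differentiable_coord.
pose c (w : 'rV[R]_m) := w ord0 i.
have lc : linear c by move=> a u u'; rewrite /c !mxE.
pose cL : {linear 'rV[R]_m -> R} := HB.pack c (GRing.isLinear.Build _ _ _ _ _ lc).
have /(congr1 (fun F => F v)) // := @diff_lin _ _ _ cL w (@coord_continuous _ _ _ _ _).
Qed.

Lemma flat_tnorm n (G : lattice R n) (x : flat G) v :
  tnorm (M := flat_riemannian G) x v = Num.sqrt (\sum_i v ord0 i ^+ 2).
Proof.
rewrite /tnorm /bilin mulmx1 mxE; congr Num.sqrt.
by apply: eq_bigr => i _; rewrite mxE expr2.
Qed.

Section OperatorNorm.
Variables (n : nat) (G : lattice R n).
Let M := flat_riemannian G.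
Implicit Types (f : flat G -> flat G) (x : flat G).

Lemma flat_tnorm_ge0 x v : 0 <= tnorm (M := M) x v.
Proof. exact: sqrtr_ge0. Qed.

Lemma flat_tnormZ x a v : tnorm (M := M) x (a *: v) = `|a| * tnorm (M := M) x v.
Proof.
rewrite !flat_tnorm -sqrtr_sqr -sqrtrM ?sqr_ge0//; congr Num.sqrt.
by rewrite mulr_sumr; apply: eq_bigr => i _; rewrite mxE exprMn.
Qed.

Lemma flat_tnorm_gt0 x v : v != 0 -> 0 < tnorm (M := M) x v.
Proof.
move=> v0; rewrite sqrtr_gt0.
by have [_ + _] := flat_metric G; apply.
Qed.

Lemma opnorm_le f x (V : {vspace 'rV[R]_n}) c : 0 <= c ->
  (forall v, v \in V ->
    tnorm (M := M) (f x) (tangent_map (M := M) (N := M) f x v) <= c * tnorm (M := M) x v) ->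
  opnorm (M := M) f x V <= c.
Proof.
move=> c0 H; apply: ge_sup.
  exists (tnorm (M := M) (f x) (tangent_map (M := M) (N := M) f x 0)); exists 0 => //; split; first exact: mem0v.
  by rewrite flat_tnorm big1 ?sqrtr0// => i _; rewrite mxE expr0n.
move=> _ [v [vV v1] <-]; apply: le_trans (H _ vV) _.
by rewrite -[leRHS]mulr1 ler_wpM2l.
Qed.

(** The upper bound [C] makes the supremum a genuine one: [sup] of an unbounded set is 0 by
    convention. *)
Lemma opnorm_ge f x (V : {vspace 'rV[R]_n}) c C v : v \in V -> v != 0 ->
  (forall v, v \in V ->
    tnorm (M := M) (f x) (tangent_map (M := M) (N := M) f x v) <= C * tnorm (M := M) x v) ->
  c * tnorm (M := M) x v <= tnorm (M := M) (f x) (tangent_map (M := M) (N := M) f x v) ->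
  c <= opnorm (M := M) f x V.
Proof.
move=> vV v0 HC Hc.
have nv := flat_tnorm_gt0 x v0.
set a := (tnorm (M := M) x v)^-1.
have a0 : 0 < a by rewrite invr_gt0.
apply: (@le_trans _ _ (tnorm (M := M) (f x) (tangent_map (M := M) (N := M) f x (a *: v)))).
  by rewrite linearZ flat_tnormZ gtr0_norm// mulrC ler_pdivlMr.
apply: ub_le_sup.
  exists `|C| => _ [u [uV u1] <-]; apply: le_trans (HC _ uV) _.
  apply: (@le_trans _ _ (`|C| * tnorm (M := M) x u)).
    by rewrite ler_wpM2r ?flat_tnorm_ge0 ?ler_norm.
  by rewrite -[leRHS]mulr1 ler_wpM2l.
exists (a *: v) => //; split; first exact: memvZ.
by rewrite flat_tnormZ gtr0_norm// mulVf// gt_eqF.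
Qed.

Lemma opnorm_ge0 f x (V : {vspace 'rV[R]_n}) : 0 <= opnorm (M := M) f x V.
Proof.
have [h|h] := pselect (has_sup [set tnorm (M := M) (f x) (tangent_map (M := M) (N := M) f x v) |
  v in [set v | v \in V /\ tnorm (M := M) x v <= 1]]); last by rewrite /opnorm sup_out.
have [_ [v vV _]] := h.1.
by apply: (le_trans (flat_tnorm_ge0 (f x) _)); apply: (ub_le_sup h.2); exists v.
Qed.

Section Diagonal.
Variables (f : flat G -> flat G) (x : flat G) (d : 'I_n -> R).
Hypothesis fd : forall v i, tangent_map (M := M) (N := M) f x v ord0 i = d i * v ord0 i.

Lemma diagonal_tnorm_le c (v : 'rV[R]_n) : 0 <= c ->
  (forall i, v ord0 i != 0 -> `|d i| <= c) ->
  tnorm (M := M) (f x) (tangent_map (M := M) (N := M) f x v) <= c * tnorm (M := M) x v.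
Proof.
move=> c0 dc; rewrite !flat_tnorm -[c]ger0_norm// -sqrtr_sqr -sqrtrM ?sqr_ge0//.
apply: ler_wsqrtr; rewrite mulr_sumr; apply: ler_sum => i _; rewrite fd exprMn.
have [->|vi] := eqVneq (v ord0 i) 0; first by rewrite expr0n !mulr0.
rewrite ler_wpM2r ?sqr_ge0// -[d i ^+ 2]real_normK ?num_real//.
by rewrite lerXn2r ?nnegrE ?normr_ge0// dc.
Qed.

Lemma diagonal_tnorm_ge c (v : 'rV[R]_n) : 0 <= c ->
  (forall i, v ord0 i != 0 -> c <= `|d i|) ->
  c * tnorm (M := M) x v <= tnorm (M := M) (f x) (tangent_map (M := M) (N := M) f x v).
Proof.
move=> c0 dc; rewrite !flat_tnorm -[c]ger0_norm// -sqrtr_sqr -sqrtrM ?sqr_ge0//.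
apply: ler_wsqrtr; rewrite mulr_sumr; apply: ler_sum => i _; rewrite fd exprMn.
have [->|vi] := eqVneq (v ord0 i) 0; first by rewrite expr0n !mulr0.
rewrite ler_wpM2r ?sqr_ge0// -[d i ^+ 2]real_normK ?num_real//.
by rewrite lerXn2r ?nnegrE ?normr_ge0// dc.
Qed.

Lemma diagonal_opnorm_ge c (V : {vspace 'rV[R]_n}) v : 0 <= c -> v \in V -> v != 0 ->
  (forall i, v ord0 i != 0 -> c <= `|d i|) -> c <= opnorm (M := M) f x V.
Proof.
move=> c0 vV v0 dc.
(* The sum of all [|d i|] is a crude bound that only serves to show that the supremum is finite. *)
apply: (@opnorm_ge _ _ _ c (\sum_i `|d i|) v) => //; last exact: diagonal_tnorm_ge.
move=> u _; apply: diagonal_tnorm_le; first by apply: sumr_ge0.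
move=> i _; rewrite (bigD1 i)//= lerDl; exact: sumr_ge0.
Qed.

End Diagonal.

End OperatorNorm.

Lemma flat_tangent_coord_img n (G : lattice R n) p x (V : {vspace 'rV[R]_n}) :
  chart_dom (flat_chart p) x ->
  (tangent_coord (M := flat_manifold G) p x @: V)%VS = V.
Proof.
move=> px; rewrite (_ : tangent_coord (M := flat_manifold G) p x = \1%VF) ?lim1g//.
by apply/lfunP => v; rewrite id_lfunE flat_tangent_coord.
Qed.

Lemma flat_continuous_subbundle n (G : lattice R n) (L : set (flat G))
    (V : flat G -> {vspace 'rV[R]_n}) k (e : 'I_k -> flat G -> 'rV[R]_n) :
  (forall i, continuous (e i)) ->
  (forall x, basis_of (V x) [seq e i x | i <- enum 'I_k]) ->
  continuous_subbundle (M := flat_manifold G) L V.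
Proof.
move=> ce be p Lp; exists k, e, (chart_dom (flat_chart p)); split.
- exact: flat_chart_dom_open.
- exact: flat_chart_dom_center.
- by [].
- by move=> i; exact: continuous_subspaceT.
- by move=> x [px _]; rewrite flat_tangent_coord_img.
Qed.

Lemma vlineZ (V : vectType R) (v : V) a : a != 0 -> <[a *: v]>%VS = <[v]>%VS.
Proof.
move=> a0; apply/eqP; rewrite eqEsubv; apply/andP; split; rewrite -memvE.
  by rewrite memvZ// memv_line.
by rewrite -{1}[v]scale1r -(mulVf a0) -scalerA memvZ// memv_line.
Qed.

(** From exp x >= 1 + x, any [m] above [K / (lambda * c)] will do. It gives a time at which
    domination forces a product of norms below 1; multiples of [c] are wanted so that the time can
    be a period. *)
Lemma exp_decay_le1 (K lambda c : R) : 0 < lambda -> 0 < c ->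
  exists2 m : nat, (0 < m)%N & K * expR (- (lambda * (c * m%:R))) <= 1.
Proof.
move=> l0 c0; have lc0 : 0 < lambda * c by rewrite mulr_gt0.
exists (Num.truncn (K / (lambda * c))).+1 => //.
set m := _.+1.
rewrite expRN ler_pdivrMr ?expR_gt0// mul1r.
apply: le_trans (expR_ge1Dx _); rewrite mulrA -[leLHS]add0r lerD//.
by rewrite mulrC -ler_pdivrMr// ltW// truncnS_gt.
Qed.

(** Rank and nullity: the first coordinate is a linear form, so its image has dimension at most 1
    and its kernel meets [V]. *)
Lemma subspace_coord0 n (V : {vspace 'rV[R]_n.+1}) : (2 <= \dim V)%N ->
  exists2 v, v \in V & v != 0 /\ v ord0 ord0 = 0.
Proof.
move=> dV.
pose c (w : 'rV[R]_n.+1) : R^o := w ord0 ord0.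
have lc : linear c by move=> a u u'; rewrite /c !mxE.
pose cL : {linear 'rV[R]_n.+1 -> R^o} := HB.pack c (GRing.isLinear.Build _ _ _ _ _ lc).
have := limg_ker_dim (linfun cL) V.
have : (\dim (linfun cL @: V) <= 1)%N.
  by apply: leq_trans (dimvS (subvf _)) _; rewrite dimvf.
move=> d1 dE; have : (V :&: lker (linfun cL))%VS != 0%VS.
  by rewrite -dimv_eq0 -lt0n -(ltn_add2r (\dim (linfun cL @: V))) dE add0n; exact: leq_ltn_trans d1 dV.
rewrite -vpick0 => v0; exists (vpick (V :&: lker (linfun cL))%VS).
  by have := memv_pick (V :&: lker (linfun cL))%VS; rewrite memv_cap => /andP[].
split=> //; have := memv_pick (V :&: lker (linfun cL))%VS; rewrite memv_cap => /andP[_].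
by rewrite memv_ker lfunE => /eqP.
Qed.

End Flat.

(** * A source and a saddle joined by an orbit *)

Section Heteroclinic.
Variable R : realType.

Local Notation i0 := (@Ordinal 3 0 isT).
Local Notation i1 := (@Ordinal 3 1 isT).
Local Notation i2 := (@Ordinal 3 2 isT).

Lemma ord3P (i : 'I_3) : [\/ i = i0, i = i1 | i = i2].
Proof.
by case: i => -[|[|[|//]]] hi; [constructor 1|constructor 2|constructor 3]; exact: val_inj.
Qed.

(** Entries past the end of [s] are 0, so [row_of 3 [:: a]] is a point of the first axis. *)
Definition row_of n (s : seq R) : 'rV[R]_n := \row_j s`_j.

Definition het_flow (t : R) (w : 'rV[R]_3) : 'rV[R]_3 :=
  row_of 3 [:: ang t (w ord0 i0); expR (2 * t) * w ord0 i1; expR (- t) * w ord0 i2].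

Definition het_field (w : 'rV[R]_3) : 'rV[R]_3 :=
  row_of 3 [:: - (sin (w ord0 i0) * cos (w ord0 i0)); 2 * w ord0 i1; - w ord0 i2].

(* [rho2 t 0 = 1], so the rates at the origin are exp(-t), exp(2t) and exp(-t). *)
Definition het_rate (t : R) (w : 'rV[R]_3) (i : 'I_3) : R :=
  [:: expR (- t) / rho2 t (w ord0 i0); expR (2 * t); expR (- t)]`_i.

Lemma het_flow_smooth :
  smooth_on setT (fun w : 'rV[R]_(3 + 1) => het_flow (rsubmx w ord0 ord0) (lsubmx w)).
Proof.
move=> k; apply: Ck_row => i.
have kt : Ck k setT (fun w : 'rV[R]_(3 + 1) => rsubmx w ord0 ord0).
  apply: (@Ck_ext R _ _ _ _ (fun w : 'rV[R]_(3 + 1) => w ord0 (rshift 3 (ord0 : 'I_1)))).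
    by move=> w; rewrite mxE.
  exact: Ck_coord.
have kc j : Ck k setT (fun w : 'rV[R]_(3 + 1) => lsubmx w ord0 j).
  apply: (@Ck_ext R _ _ _ _ (fun w : 'rV[R]_(3 + 1) => w ord0 (lshift 1 j))).
    by move=> w; rewrite mxE.
  exact: Ck_coord.
apply: (@Ck_ext R _ _ _ _ (fun w => [:: ang (rsubmx w ord0 ord0) (lsubmx w ord0 i0);
   expR (2 * rsubmx w ord0 ord0) * lsubmx w ord0 i1;
   expR (- rsubmx w ord0 ord0) * lsubmx w ord0 i2]`_i)).
  by move=> w; rewrite [RHS]mxE.
have [->|->|->] := ord3P i => /=.
- exact: Ck_ang.
- apply: Ck_mul => //; apply: Ck_exp; apply: Ck_mul => //; exact: Ck_const.
- apply: Ck_mul => //; apply: Ck_exp; exact: Ck_opp.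
Qed.

Lemma het_flow_smooth_space t : smooth_on setT (het_flow t).
Proof.
move=> k; apply: Ck_row => i.
apply: (@Ck_ext R _ _ _ _ (fun w : 'rV[R]_3 => [:: ang t (w ord0 i0);
   expR (2 * t) * w ord0 i1; expR (- t) * w ord0 i2]`_i)).
  by move=> w; rewrite mxE.
have [->|->|->] := ord3P i => /=.
- apply: (@Ck_ang _ _ _ (cst t)); [exact: Ck_const|exact: Ck_coord].
- apply: Ck_mul; [exact: Ck_const|exact: Ck_coord].
- apply: Ck_mul; [exact: Ck_const|exact: Ck_coord].
Qed.

Lemma het_field_smooth : smooth_on setT het_field.
Proof.
move=> k; apply: Ck_row => i.
apply: (@Ck_ext R _ _ _ _ (fun w : 'rV[R]_3 => [:: - (sin (w ord0 i0) * cos (w ord0 i0));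
   2 * w ord0 i1; - w ord0 i2]`_i)).
  by move=> w; rewrite mxE.
have [ks kc] := Ck_sin_cos (@Ck_coord R 3 k i0).
have [->|->|->] := ord3P i => /=.
- by apply: Ck_opp; exact: Ck_mul.
- apply: Ck_mul; [exact: Ck_const|exact: Ck_coord].
- apply: Ck_opp; exact: Ck_coord.
Qed.

Lemma het_flow_derive t w v i : derive (het_flow t) w v ord0 i = het_rate t w i * v ord0 i.
Proof.
rewrite derive_coord; last exact: het_flow_smooth_space.
have H c j : is_derive (w ord0 j) (1 : R) (fun x : R => c * x) c.
  have := is_deriveZ c (is_derive_id (w ord0 j) (1 : R)).
  by move=> /is_derive_eq; apply; rewrite /GRing.scale/= mulr1.
rewrite /het_rate; have [->|->|->] := ord3P i => /=.
- rewrite (_ : (fun w => _) = (fun w : 'rV[R]_3 => ang t (w ord0 i0))).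
    by have [_ ->] := derive_comp_coord v (is_derive_ang t (w ord0 i0)).
  by apply/funext => u; rewrite mxE.
- rewrite (_ : (fun w => _) = (fun w : 'rV[R]_3 => expR (2 * t) * (w ord0 i1))).
    by have [_ ->] := derive_comp_coord v (H (expR (2 * t)) i1).
  by apply/funext => u; rewrite mxE.
- rewrite (_ : (fun w => _) = (fun w : 'rV[R]_3 => expR (- t) * (w ord0 i2))).
    by have [_ ->] := derive_comp_coord v (H (expR (- t)) i2).
  by apply/funext => u; rewrite mxE.
Qed.

Lemma het_flow_time t w : is_derive t (1 : R) (het_flow ^~ w) (het_field (het_flow t w)).
Proof.
have H c b : is_derive t (1 : R) (fun s : R => expR (c * s) * b) (c * (expR (c * t) * b)).
  have := is_derive_mul (is_derive_chain (is_derive_mul (is_derive_cst c t 1) (is_derive_id t 1))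
    (is_derive_expR _)) (is_derive_cst b t 1).
  by move=> /is_derive_eq; apply; rewrite /cst; ring.
have D i : is_derive t (1 : R) (fun s => het_flow s w ord0 i) (het_field (het_flow t w) ord0 i).
  have [->|->|->] := ord3P i.
  - rewrite !mxE/= (_ : (fun s => _) = (fun s : R => ang s (w ord0 i0))); last by apply/funext => u; rewrite mxE.
    exact: is_derive_ang_time.
  - rewrite !mxE/= (_ : (fun s => _) = (fun s => expR (2 * s) * w ord0 i1)); last by apply/funext => u; rewrite mxE.
    exact: H.
  - rewrite !mxE/= (_ : (fun s => _) = (fun s => expR (-1 * s) * w ord0 i2)).
      by have := H (-1) (w ord0 i2); rewrite !mulN1r.
    by apply/funext => u; rewrite mxE mulN1r.
have dh : derivable (het_flow ^~ w) t 1.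
  by apply/derivable_mxP => i j; rewrite ord1; case: (D j).
split=> //; rewrite derive_mx//; apply/rowP => i; rewrite mxE.
by case: (D i).
Qed.

Lemma het_flowD s t w : het_flow (s + t) w = het_flow s (het_flow t w).
Proof.
apply/rowP => i; rewrite !mxE; have [->|->|->] := ord3P i => /=; rewrite ?mxE/=.
- exact: angD.
- by rewrite mulrDr expRD mulrA.
- by rewrite opprD expRD mulrA.
Qed.

Lemma het_flow0 w : het_flow 0 w = w.
Proof.
apply/rowP => i; rewrite !mxE; have [->|->|->] := ord3P i => /=.
- exact: ang0t.
- by rewrite mulr0 expR0 mul1r.
- by rewrite oppr0 expR0 mul1r.
Qed.

Lemma trivial_latticeB n (u v : 'rV[R]_n) : u = 0 -> v = 0 -> u - v = 0.
Proof. by move=> -> ->; rewrite subr0. Qed.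

Definition trivial_lattice n : lattice R n :=
  @Lattice R n (fun u => u = 0) erefl (@trivial_latticeB n) (fun u u0 _ => u0).

Let G := trivial_lattice 3.
Let M := flat_riemannian G.

Definition het_phi (t : R) : flat G -> flat G := descend G (het_flow t).
Definition het_X (x : flat G) : 'rV[R]_3 := het_field (flat_repr x).
Definition het_set : set (flat G) :=
  [set x | exists2 a : R, 0 <= a <= pi / 2 & x = flat_proj G (row_of 3 [:: a])].
Definition het_E (x : flat G) : {vspace 'rV[R]_3} := <[delta_mx ord0 i2]>%VS.
Definition het_F (x : flat G) : {vspace 'rV[R]_3} :=
  (<[delta_mx ord0 i0]> + <[delta_mx ord0 i1]>)%VS.

Lemma het_phiE t w : het_phi t (flat_proj G w) = flat_proj G (het_flow t w).
Proof. by apply: descendE => u g ->; rewrite addr0 subrr. Qed.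

Lemma trivial_flat_reprK w : flat_repr (flat_proj G w) = w.
Proof.
have /flat_projP := flat_reprK (flat_proj G w).
exact: (@subr0_eq 'rV[R]_3).
Qed.

Lemma het_XE w : het_X (flat_proj G w) = het_field w.
Proof. by rewrite /het_X trivial_flat_reprK. Qed.

Lemma het_phiD s t x : het_phi (s + t) x = het_phi s (het_phi t x).
Proof. by rewrite -(flat_reprK x) !het_phiE het_flowD. Qed.

Lemma het_phi0 x : het_phi 0 x = x.
Proof. by rewrite -(flat_reprK x) het_phiE het_flow0. Qed.

Lemma het_generates : generates (M := M) het_X het_phi.
Proof.
split; first split.
- exact: het_phi0.
- exact: het_phiD.
- apply: (flat_smooth_map_prod het_flow_smooth) => w s.
  by rewrite row_mxKl row_mxKr /= mxE mulr1n het_phiE.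
- move=> x t; rewrite -(flat_reprK x); set w := flat_repr x.
  rewrite het_phiE het_XE flat_chartsE.
  have dt := het_flow_time t w.
  (* In the chart at the current point the orbit is the lifted orbit plus a constant, so both have
     the same velocity. *)
  have [||g _ Hg] := @flat_chart_near _ _ G _ (het_flow ^~ w) t (flat_proj G (het_flow t w)).
  + by apply/differentiable_continuous/derivable1_diffP; case: dt.
  + exact: flat_chart_dom_center.
  have dg : is_derive t (1 : R) (fun s => het_flow s w + g) (het_field (het_flow t w)).
    by have := is_deriveD dt (is_derive_cst g t (1 : R)); rewrite addr0.
  apply: near_eq_is_derive dg.
  by apply: filterS Hg => s <-; rewrite het_phiE.
Qed.

Lemma het_tangent t x v i :
  tangent_map (M := M) (N := M) (het_phi t) x v ord0 i = het_rate t (flat_repr x) i * v ord0 i.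
Proof.
rewrite (flat_tangent_map v (het_flow_smooth_space t) (het_phiE t) (flat_reprK x)).
exact: het_flow_derive.
Qed.

Lemma het_rate_gt0 t w i : 0 < het_rate t w i.
Proof.
rewrite /het_rate; have [->|->|->] := ord3P i => /=; rewrite ?expR_gt0//.
by rewrite divr_gt0 ?expR_gt0 ?rho2_gt0.
Qed.

Lemma het_tangent_delta t x i :
  tangent_map (M := M) (N := M) (het_phi t) x (delta_mx ord0 i)
  = het_rate t (flat_repr x) i *: delta_mx ord0 i.
Proof.
apply/rowP => j; rewrite het_tangent !mxE eqxx /=.
by have [->|] := eqVneq j i; rewrite ?mulr0.
Qed.

Lemma mem_het_E x (v : 'rV[R]_3) : v \in het_E x -> v ord0 i0 = 0 /\ v ord0 i1 = 0.
Proof. by move=> /vlineP[a ->]; rewrite !mxE !mulr0. Qed.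

Lemma mem_het_F x (v : 'rV[R]_3) : v \in het_F x -> v ord0 i2 = 0.
Proof. by move=> /memv_addP[_ /vlineP[a ->] [_ /vlineP[b ->] ->]]; rewrite !mxE !mulr0 addr0. Qed.

Lemma het_basis_E x : basis_of (het_E x) [:: delta_mx ord0 i2].
Proof.
rewrite /basis_of span_seq1 eqxx seq1_free; apply/eqP => /rowP/(_ i2)/eqP.
by rewrite !mxE eqxx oner_eq0.
Qed.

Lemma het_basis_F x : basis_of (het_F x) [:: delta_mx ord0 i0; delta_mx ord0 i1].
Proof.
rewrite /basis_of span_cons span_seq1 eqxx free_cons seq1_free span_seq1 /=.
apply/andP; split; apply/negP.
  by move=> /vlineP[a] /rowP/(_ i0)/eqP; rewrite !mxE mulr0 oner_eq0.
by move=> /eqP/rowP/(_ i1)/eqP; rewrite !mxE oner_eq0.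
Qed.

Lemma dim_het_F x : \dim (het_F x) = 2%N.
Proof. exact: (@size_basis _ _ _ 2 [tuple _; _] (het_basis_F x)). Qed.

Lemma map_nth_enum_ord (T : Type) (x0 : T) k (s : seq T) :
  size s = k -> [seq nth x0 s (nat_of_ord i) | i <- enum 'I_k] = s.
Proof.
by move=> <-; rewrite (map_comp (nth x0 s) (@nat_of_ord _)) val_enum_ord map_nth_iota0// take_size.
Qed.

Lemma het_splitting : continuous_invariant_splitting (M := M) het_phi het_set het_E het_F.
Proof.
split.
- move=> x _; split.
  + rewrite -subv0 -memvE; apply/negP; rewrite memv0 => /eqP/rowP/(_ i2)/eqP.
    by rewrite !mxE oner_eq0.
  + by rewrite -dimv_eq0 dim_het_F.
  + apply/eqP; rewrite eqEsubv subvf /=; apply/subvP => v _; apply/memv_addP.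
    exists (v ord0 i2 *: delta_mx ord0 i2); first by rewrite memvZ// memv_line.
    exists (v ord0 i0 *: delta_mx ord0 i0 + v ord0 i1 *: delta_mx ord0 i1).
      by rewrite memv_add// memvZ// memv_line.
    apply/rowP => i; rewrite !mxE; have [->|->|->] := ord3P i;
    by rewrite !mulr0 ?mulr1 ?addr0 ?add0r.
  + apply/eqP; rewrite -subv0; apply/subvP => v.
    rewrite memv_cap => /andP[/mem_het_E[v0 v1] /mem_het_F v2].
    rewrite memv0; apply/eqP/rowP => i; rewrite mxE.
    by have [->|->|->] := ord3P i.
- apply: (@flat_continuous_subbundle _ _ _ _ _ 1 (fun i _ => [:: delta_mx ord0 i2]`_i)).
    by move=> i; exact: cst_continuous.
  by move=> x; rewrite map_nth_enum_ord//; exact: het_basis_E.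
- apply: (@flat_continuous_subbundle _ _ _ _ _ 2
    (fun i _ => [:: delta_mx ord0 i0; delta_mx ord0 i1]`_i)).
    by move=> i; exact: cst_continuous.
  by move=> x; rewrite map_nth_enum_ord//; exact: het_basis_F.
- move=> t x _; rewrite limg_line het_tangent_delta vlineZ//.
  by rewrite gt_eqF// het_rate_gt0.
- move=> t x _; rewrite limgD !limg_line !het_tangent_delta !vlineZ//.
  + by rewrite gt_eqF// het_rate_gt0.
  + by rewrite gt_eqF// het_rate_gt0.
Qed.

Lemma het_contracted : uniformly_contracted (M := M) het_phi het_set het_E.
Proof.
exists 1, 1; split=> // x t _ t0; rewrite !mul1r.
apply: opnorm_le; first exact: expR_ge0.
move=> v /mem_het_E[v0 v1]; apply: (diagonal_tnorm_le (d := het_rate t (flat_repr x))).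
- by move=> u i; exact: het_tangent.
- exact: expR_ge0.
- move=> i; have [->|->|->] := ord3P i; rewrite ?v0 ?v1 ?eqxx// => _.
  by rewrite /het_rate /= ger0_norm// expR_ge0.
Qed.

(** * Area growth in the plane of the first two directions *)

Lemma det2 (A : 'M[R]_2) : \det A = A 0 0 * A 1 1 - A 0 1 * A 1 0.
Proof.
rewrite (expand_det_row _ ord0) !big_ord_recl big_ord0 addr0.
rewrite /cofactor !det_mx11 !mxE/= expr0 expr1 mul1r mulN1r mulrN.
congr (A _ _ * A _ _ - A _ _ * A _ _); exact: val_inj.
Qed.

(** Lagrange's identity: the Gram determinant of two vectors is the square of the area they span. *)
Lemma gram_plane k (x : flat G) (e : 'I_k.+2 -> 'rV[R]_3) : k = 0%N ->
  (forall i, e i ord0 i2 = 0) ->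
  gram (M := M) x e =
    (e ord0 ord0 i0 * e ord_max ord0 i1 - e ord0 ord0 i1 * e ord_max ord0 i0) ^+ 2.
Proof.
move=> k0; subst k => e2; rewrite /gram det2 !mxE /bilin !mulmx1 !mxE.
have -> : (1 : 'I_2) = ord_max by exact: val_inj.
rewrite !big_ord_recl !big_ord0 !mxE.
have -> : lift (ord0 : 'I_3) (lift ord0 ord0) = i2 by exact: val_inj.
have -> : lift (ord0 : 'I_3) ord0 = i1 by exact: val_inj.
have -> : (ord0 : 'I_3) = i0 by exact: val_inj.
rewrite !e2; ring.
Qed.

(** If the 2 by 2 determinant vanished, the pairs (b1, -a1) and (b0, -a0) would be coefficients of
    linear relations between the two vectors [a] and [b], and freeness would kill all coordinates.
    The size is a variable equal to 2 because it gets instantiated by [\dim P]. *)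
Lemma gram_plane_gt0 k (x : flat G) (X : k.-tuple 'rV[R]_3) : k = 2%N ->
  free X -> (forall i : 'I_k, X`_i ord0 i2 = 0) ->
  0 < gram (M := M) x (fun i : 'I_k => X`_i).
Proof.
move=> k2; subst k => /freeP fX X2.
rewrite (@gram_plane 0)// lt_def sqr_ge0 andbT sqrf_eq0.
have sumX (c : 'I_2 -> R) : (forall i, c ord0 * X`_(ord0 : 'I_2) ord0 i + c ord_max * X`_(ord_max : 'I_2) ord0 i = 0) ->
    c ord0 = 0 /\ c ord_max = 0.
  move=> cX; have H : forall i : 'I_2, c i = 0; last by split.
  apply: fX; rewrite !big_ord_recl big_ord0 addr0.
  have -> : lift ord0 ord0 = (ord_max : 'I_2) by exact: val_inj.
  by apply/rowP => i; rewrite !mxE cX.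
set a := X`_(ord0 : 'I_2); set b := X`_(ord_max : 'I_2).
have a2 : a ord0 i2 = 0 := X2 ord0; have b2 : b ord0 i2 = 0 := X2 ord_max.
apply/eqP => ab.
have [|b1 a1] := @sumX (fun i => if i == ord0 then b ord0 i1 else - a ord0 i1).
  move=> i /=; have [->|->|->] := ord3P i; rewrite -/a -/b ?a2 ?b2; last by rewrite !mulr0 addr0.
    by rewrite mulrC mulNr.
  by rewrite mulrC mulNr subrr.
have [|b0 a0] := @sumX (fun i => if i == ord0 then b ord0 i0 else - a ord0 i0).
  move=> i /=; have [->|->|->] := ord3P i; rewrite -/a -/b ?a2 ?b2; last by rewrite !mulr0 addr0.
    by rewrite mulrC mulNr subrr.
  by rewrite -oppr0 -ab; ring.
(* With all coordinates zero, the coefficients 1 and 1 also form a relation, contradicting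
   freeness. *)
have [|/eqP] := @sumX (fun=> 1); last by rewrite oner_eq0.
move: b1 a1 b0 a0 => /= b1 /eqP + b0 /eqP; rewrite !oppr_eq0 => /eqP a1 /eqP a0.
by move=> i; have [->|->|->] := ord3P i; rewrite -/a -/b ?a2 ?b2 ?a1 ?b1 ?a0 ?b0 mulr0 addr0.
Qed.

(** A two-dimensional [P] with vanishing third coordinate is the whole coordinate plane, so the
    factor is the product of the two diagonal entries, whatever basis [vbasis] picks. *)
Lemma absdet_plane (f : flat G -> flat G) x (P : {vspace 'rV[R]_3}) d :
  (forall v i, tangent_map (M := M) (N := M) f x v ord0 i = d i * v ord0 i) ->
  \dim P = 2%N -> (forall v, v \in P -> v ord0 i2 = 0) ->
  absdet (M := M) f x P = `|d i0 * d i1|.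
Proof.
move=> fd dP P2; rewrite /absdet.
have bP : free (vbasis P) := basis_free (vbasisP P).
have b2 (i : 'I_(\dim P)) : (vbasis P)`_i ord0 i2 = 0.
  by apply: P2; apply/vbasis_mem/mem_nth; rewrite size_tuple.
have g0 := gram_plane_gt0 x dP bP b2.
suff -> : gram (M := M) (f x) (fun i : 'I_(\dim P) => tangent_map (M := M) (N := M) f x (vbasis P)`_i)
   = (d i0 * d i1) ^+ 2 * gram (M := M) x (fun i : 'I_(\dim P) => (vbasis P)`_i).
  by rewrite sqrtrM ?sqr_ge0// mulfK ?sqrtr_sqr// gt_eqF// sqrtr_gt0.
move: (vbasis P) b2 {bP g0}; rewrite dP => X X2.
rewrite !(@gram_plane 0)//; last by move=> i; rewrite fd X2 mulr0.
by rewrite !fd; ring.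
Qed.

Lemma het_expanding : sectionally_expanding (M := M) het_phi het_set het_F.
Proof.
split; first by have [] := het_splitting.
  by exists 2%N => // x _; exact: dim_het_F.
(* The area factor is exp t / r with r <= 1, hence at least exp t; the constant 1/2 makes the
   inequality strict. *)
exists (2^-1), 1; split; rewrite ?invr_gt0// => x P t Lx PF dP t0.
rewrite (absdet_plane (d := het_rate t (flat_repr x)))//; last 2 first.
- by move=> v i; exact: het_tangent.
- by move=> v vP; apply: (@mem_het_F x); exact: (subvP PF).
rewrite ger0_norm; last by rewrite mulr_ge0// ltW// het_rate_gt0.
rewrite /het_rate /= mul1r; set r := rho2 _ _.
have r0 : 0 < r := rho2_gt0 _ _.
have r1 : r <= 1 := rho2_le1 _ (ltW t0).
rewrite mulrAC -expRD (_ : - t + 2 * t = t); last by ring.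
apply: (@lt_le_trans _ _ (expR t)).
  by rewrite gtr_pMl ?expR_gt0// invf_lt1// ltr1n.
by rewrite ler_peMr ?expR_ge0// invf_ge1.
Qed.

(** * The invariant arc and its singularity at the origin *)

Lemma het_phi_row t a : het_phi t (flat_proj G (row_of 3 [:: a])) = flat_proj G (row_of 3 [:: ang t a]).
Proof.
rewrite het_phiE; congr (flat_proj G _); apply/rowP => i; rewrite !mxE.
by have [->|->|->] := ord3P i; rewrite /= ?mulr0.
Qed.

Lemma het_set_sub t x : het_set x -> het_set (het_phi t x).
Proof.
move=> [a a0 ->]; exists (ang t a); first exact: ang_quadrant.
exact: het_phi_row.
Qed.

Lemma het_invariant : invariant_set het_phi het_set.
Proof.
move=> t; apply/seteqP; split=> [_ [x Lx <-]|x Lx]; first exact: het_set_sub.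
exists (het_phi (- t) x); first exact: het_set_sub.
by rewrite -het_phiD subrr het_phi0.
Qed.

Lemma row_of1_continuous : continuous (fun a : R => flat_proj G (row_of 3 [:: a])).
Proof.
move=> a; apply: (@continuous_comp _ _ _ (fun a : R => row_of 3 [:: a])); last exact: flat_proj_continuous.
apply: continuous_row => i; rewrite (_ : (fun x => _) = (fun x : R => [:: x]`_i)); last first.
  by apply/funext => x; rewrite mxE.
by have [->|->|->] := ord3P i; [exact: cvg_id|exact: cvg_cst|exact: cvg_cst].
Qed.

Lemma het_compact : compact het_set.
Proof.
rewrite (_ : het_set = (fun a : R => flat_proj G (row_of 3 [:: a])) @` `[0, pi / 2]%classic).
  apply: continuous_compact; last exact: segment_compact.
  exact/continuous_subspaceT/row_of1_continuous.
apply/seteqP; split=> x.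
  by move=> [a a0 ->]; exists a => //=; rewrite in_itv.
by move=> [a /=]; rewrite in_itv/= => a0 <-; exists a.
Qed.

Lemma het_singularity : het_X (flat_proj G (row_of 3 [:: 0])) = 0.
Proof.
rewrite het_XE; apply/rowP => i; rewrite !mxE.
by have [->|->|->] := ord3P i; rewrite /= ?sin0 ?mul0r ?mulr0 ?oppr0.
Qed.

Lemma het_singular_limit :
  limit_of_regular_orbits (M := M) het_X het_phi het_set (flat_proj G (row_of 3 [:: 0])).
Proof.
move=> A /row_of1_continuous A0.
have p0 : 0 < pi / 2 :> R by rewrite divr_gt0// pi_gt0.
have [a [/= aA a0 ap]] : exists a : R, [/\ A (flat_proj G (row_of 3 [:: a])), 0 < a & a < pi / 2].
  have /nbhs_ballP[e /= e0 eA] := A0.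
  (* Below [e] to stay in the neighbourhood, and below pi/2 so that sine and cosine are both
     positive and the point is regular. *)
  exists (Num.min (e / 2) (pi / 4)); split.
  - apply: eA; rewrite /ball/= sub0r normrN ger0_norm; last first.
      by rewrite le_min !divr_ge0 ?(ltW e0)// pi_ge0.
    by rewrite gt_min ltr_pdivrMr// ltr_pMr// ltr1n.
  - by rewrite lt_min !divr_gt0// pi_gt0.
  - by rewrite gt_min; apply/orP; right; rewrite ltr_pM2l ?pi_gt0// ltf_pV2 ?posrE// ltr_nat.
set x := flat_proj G (row_of 3 [:: a]); exists x; split=> //; exists x; split.
- rewrite het_XE; apply/eqP => /rowP/(_ i0)/eqP; rewrite !mxE/= oppr_eq0 gt_eqF// mulr_gt0//.
    apply: sin_gt0_pi; rewrite a0/=; apply: lt_trans ap _.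
    by rewrite ltr_pdivrMr// ltr_pMr ?pi_gt0// ltr1n.
  by apply: cos_gt0_pihalf; rewrite ap andbT (lt_trans _ a0)// oppr_lt0.
- move=> _ [t _ <-]; apply: het_set_sub; exists a => //.
  by rewrite !ltW.
- by exists 0 => //; exact: het_phi0.
Qed.

Lemma het_not_dominated :
  ~ flow_dominated_splitting (M := M) het_phi het_set het_E het_F.
Proof.
move=> [_ [K [lambda [K0 l0 H]]]].
have [m m0 Km] := exp_decay_le1 K l0 (@ltr01 R).
set s := flat_proj G (row_of 3 [:: 0]).
have Ls : het_set s by exists 0 => //; rewrite lexx/= divr_ge0// pi_ge0.
have sE t : het_phi t s = s by rewrite het_phi_row ang0.
have t0 : 0 < m%:R :> R by rewrite ltr0n.
have := H s m%:R Ls t0; rewrite sE; apply/negP; rewrite -leNgt.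
rewrite mul1r in Km; apply: (le_trans Km).
(* At the origin the forward rate of z, in [E], and the backward rate of the first axis, in [F], are
   exactly reciprocal. *)
rewrite [leLHS](_ : 1 = expR (- m%:R) * expR (m%:R)); last first.
  by rewrite mulrC expRxMexpNx_1.
have w0 : flat_repr s = row_of 3 [:: 0] by exact: trivial_flat_reprK.
have r1 t : rho2 t (row_of 3 [:: 0] ord0 i0) = 1.
  by rewrite mxE/= /rho2 sin0 cos0 expr1n expr0n mulr0 addr0.
have dn0 i : (delta_mx ord0 i : 'rV[R]_3) != 0.
  by apply/eqP => /rowP/(_ i)/eqP; rewrite !mxE !eqxx oner_eq0.
have di (i j : 'I_3) : (delta_mx ord0 i : 'rV[R]_3) ord0 j != 0 -> j = i.
  by rewrite mxE eqxx/=; case: (j =P i) => // _ /eqP; rewrite /=.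
apply: ler_pM; rewrite ?expR_ge0//.
- apply: (@diagonal_opnorm_ge _ _ _ _ _ (het_rate m%:R (flat_repr s)) _ _ _ (delta_mx ord0 i2)) => //.
  + by move=> v i; exact: het_tangent.
  + exact: memv_line.
  + by move=> i /di ->; rewrite /het_rate/= ger0_norm// expR_ge0.
- apply: (@diagonal_opnorm_ge _ _ _ _ _ (het_rate (- m%:R) (flat_repr s)) _ _ _ (delta_mx ord0 i0)) => //.
  + by move=> v i; exact: het_tangent.
  + by rewrite (subvP (addvSl _ _))// memv_line.
  + by move=> i /di ->; rewrite /het_rate/= w0 r1 opprK divr1 ger0_norm// expR_ge0.
Qed.

Lemma het_example :
  exists (n : nat) (M : riemannian R n) (X : M -> 'rV[R]_n)
      (phi : R -> M -> M) (Lambda : set M) (E F : M -> {vspace 'rV[R]_n}),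
    (smooth_vector_field X /\ generates X phi) /\
    (compact Lambda /\ invariant_set phi Lambda) /\
    (exists sigma : M, [/\ Lambda sigma, X sigma = 0
       & limit_of_regular_orbits X phi Lambda sigma]) /\
    [/\ continuous_invariant_splitting phi Lambda E F,
        uniformly_contracted phi Lambda E,
        sectionally_expanding phi Lambda F
      & ~ flow_dominated_splitting phi Lambda E F].
Proof.
exists 3%N, M, het_X, het_phi, het_set, het_E, het_F; split; [split|split; [split|split]].
- exact: (flat_smooth_vector_field het_field_smooth het_XE).
- exact: het_generates.
- exact: het_compact.
- exact: het_invariant.
- exists (flat_proj G (row_of 3 [:: 0])); split.
  + by exists 0 => //; rewrite lexx/= divr_ge0// pi_ge0.
  + exact: het_singularity.
  + exact: het_singular_limit.
- split; [exact: het_splitting|exact: het_contracted|exact: het_expanding|exact: het_not_dominated].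
Qed.

End Heteroclinic.

(** * The base diffeomorphism *)

Section Torus.
Variable R : realType.

Definition period : R := pi *+ 2.

Lemma period_gt0 : 0 < period.
Proof. by rewrite pmulrn_lgt0// pi_gt0. Qed.

Lemma period_ge2 : 2 <= period.
Proof. by rewrite /period mulr2n; have := @pi_ge2 R; lra. Qed.

Lemma period_discrete (m : int) : `|period *~ m| < 2 -> period *~ m = 0.
Proof.
have [->|m0] := eqVneq m 0; first by rewrite mulr0z.
rewrite -mulrzr normrM (gtr0_norm period_gt0) ltNge => /negP[].
apply: le_trans period_ge2 _; rewrite ler_peMr ?(ltW period_gt0)//.
by rewrite -intr_norm ler1z -gtz0_ge1 normr_gt0.
Qed.

Definition torus_set n (u : 'rV[R]_n) : Prop := forall i, exists m : int, u ord0 i = period *~ m.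

Lemma torus_set0 n : torus_set (0 : 'rV[R]_n).
Proof. by move=> i; exists 0; rewrite mxE mulr0z. Qed.

Lemma torus_setB n (u v : 'rV[R]_n) : torus_set u -> torus_set v -> torus_set (u - v).
Proof.
by move=> uP vP i; have [m uE] := uP i; have [m' vE] := vP i; exists (m - m'); rewrite !mxE uE vE mulrzBr.
Qed.

Lemma torus_set_discrete n (u : 'rV[R]_n) : torus_set u -> `|u| < 2 -> u = 0.
Proof.
move=> uP u2; apply/rowP => i; rewrite mxE; have [m uE] := uP i; rewrite uE.
apply: period_discrete; rewrite -uE.
have : ball (0 : 'rV[R]_n) 2 u by rewrite -ball_normE/= sub0r normrN.
by move=> [_ /(_ ord0 i)]; rewrite /ball/= mxE sub0r normrN.
Qed.

Definition torus n : lattice R n :=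
  Lattice (@torus_set0 n) (@torus_setB n) (@torus_set_discrete n).

Lemma torus_compact n : compact [set: flat (torus n)].
Proof.
pose A : set 'rV[R]_n := [set v | forall i, `[0, period]%classic (v ord0 i)].
rewrite (_ : setT = flat_proj (torus n) @` A).
  apply: continuous_compact; first exact/continuous_subspaceT/flat_proj_continuous.
  by apply: (@rV_compact _ _ (fun=> `[0, period]%classic)) => i; exact: segment_compact.
apply/seteqP; split=> // x _; rewrite -(flat_reprK x); set w := flat_repr x.
pose g : 'rV[R]_n := \row_i (period *~ Num.floor (w ord0 i / period)).
exists (w - g); last first.
  by apply/flat_projP => i; exists (- Num.floor (w ord0 i / period)); rewrite !mxE mulrNz addrC addKr.
move=> i; rewrite /= in_itv/= !mxE -mulrzr.
have p0 := period_gt0; set a := w ord0 i; set m := Num.floor _.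
have /andP[m1 m2] := real_floor_itv (num_real (a / period)); rewrite -/m in m1 m2.
have aE : a = period * (a / period) by rewrite mulrC divfK// gt_eqF.
apply/andP; split; rewrite {1}aE -mulrBr.
  by rewrite mulr_ge0 ?(ltW p0)// subr_ge0.
rewrite ler_piMr ?(ltW p0)// lerBlDr ltW//.
by move: m2; rewrite intrD addrC.
Qed.

Local Notation j0 := (@Ordinal 2 0 isT).
Local Notation j1 := (@Ordinal 2 1 isT).
Local Notation i0 := (@Ordinal 3 0 isT).
Local Notation i1 := (@Ordinal 3 1 isT).
Local Notation i2 := (@Ordinal 3 2 isT).

Lemma ord2P (j : 'I_2) : j = j0 \/ j = j1.
Proof. by case: j => -[|[|//]] hj; [left|right]; exact: val_inj. Qed.

(* In polar coordinates [exp y * (cos a, sin a)] this is the linear map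
   [diag(1, exp(-t))] of the punctured plane. *)
Definition base_flow (t : R) (w : 'rV[R]_2) : 'rV[R]_2 :=
  row_of 2 [:: ang t (w ord0 j0); w ord0 j1 + stretch t (w ord0 j0)].

Lemma base_flowD s t w : base_flow (s + t) w = base_flow s (base_flow t w).
Proof.
apply/rowP => j; rewrite !mxE; have [->|->] := ord2P j; rewrite /= ?mxE/= ?mxE/=.
  exact: angD.
by rewrite stretchD addrA.
Qed.

Lemma base_flow0 w : base_flow 0 w = w.
Proof.
apply/rowP => j; rewrite !mxE; have [->|->] := ord2P j => /=; first exact: ang0t.
by rewrite stretch0t addr0.
Qed.

(** A full turn moves [ang] by a full turn and leaves [stretch] unchanged, while a shift of the
    log-radius, that is a homothety, commutes with a linear map. *)
Lemma base_flow_equivariant t : equivariant (torus 2) (torus 2) (base_flow t).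
Proof.
move=> u g Gg; have [m0 g0] := Gg j0; have [m1 g1] := Gg j1.
have [cE sE] := cos_sin_period (u ord0 j0) m0.
move=> j; rewrite !mxE; have [->|->] := ord2P j => /=.
  exists m0; rewrite ?mxE g0; have := ang_rotate t cE sE; rewrite /period; lra.
by exists m1; rewrite ?mxE g0 g1 (stretch_rotate t cE sE); ring.
Qed.

Lemma Ck_base_flow (V : normedModType R) k (f : V -> R) (g : V -> 'rV[R]_2) :
  Ck k setT f -> (forall j, Ck k setT (fun x => g x ord0 j)) ->
  Ck k setT (fun x => base_flow (f x) (g x)).
Proof.
move=> kf kg; apply: Ck_row => j.
apply: (@Ck_ext R _ _ _ _ (fun x => [:: ang (f x) (g x ord0 j0);
  g x ord0 j1 + stretch (f x) (g x ord0 j0)]`_j)); first by move=> x; rewrite [RHS]mxE.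
have [->|->] := ord2P j => /=; first exact: Ck_ang.
by apply: Ck_add => //; exact: Ck_stretch.
Qed.

Lemma base_flow_smooth t : smooth_on setT (base_flow t).
Proof.
move=> k; apply: (@Ck_base_flow _ _ (cst t) id); first exact: Ck_const.
by move=> j; exact: Ck_coord.
Qed.

Definition psi t : flat (torus 2) -> flat (torus 2) := descend (torus 2) (base_flow t).

Lemma psiE t w : psi t (flat_proj _ w) = flat_proj _ (base_flow t w).
Proof. exact/descendE/base_flow_equivariant. Qed.

Lemma psiD s t x : psi (s + t) x = psi s (psi t x).
Proof. by rewrite -(flat_reprK x) !psiE base_flowD. Qed.

Lemma psi0 x : psi 0 x = x.
Proof. by rewrite -(flat_reprK x) psiE base_flow0. Qed.

Lemma psiK t : cancel (psi t) (psi (- t)).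
Proof. by move=> x; rewrite -psiD addNr psi0. Qed.

Lemma psi_smooth t : smooth_map (@flat_chart R 2 (torus 2)) (@flat_chart R 2 (torus 2)) (psi t).
Proof. exact: flat_smooth_map (base_flow_smooth t) (psiE t). Qed.

Lemma psi_diffeomorphism t :
  diffeomorphism (M := flat_manifold (torus 2)) (psi t) (psi (- t)).
Proof.
split; [exact: psiK| |exact: psi_smooth|exact: psi_smooth].
by move=> x; rewrite -{1}[t]opprK psiK.
Qed.

Lemma psi_iter t k x : iter k (psi t) x = psi (t *+ k) x.
Proof.
elim: k => [|k IH] /=; first by rewrite mulr0n psi0.
by rewrite IH -psiD mulrS.
Qed.

Lemma psi_iterz t k x : iterz (psi t) (psi (- t)) k x = psi (t *~ k) x.
Proof. by case: k => k; rewrite /iterz psi_iter// NegzE mulrNz mulNrn pmulrn. Qed.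

Lemma base_flow_derive t w v :
  derive (base_flow t) w v = row_of 2 [:: expR (- t) / rho2 t (w ord0 j0) * v ord0 j0;
    v ord0 j1 + (expR (- t) ^+ 2 - 1) * (sin (w ord0 j0) * cos (w ord0 j0))
      / rho2 t (w ord0 j0) * v ord0 j0].
Proof.
apply/rowP => j; rewrite derive_coord; last exact: base_flow_smooth.
rewrite mxE; have [->|->] := ord2P j => /=.
  rewrite (_ : (fun w => _) = (fun w : 'rV[R]_2 => ang t (w ord0 j0))).
    by have [_ ->] := derive_comp_coord v (is_derive_ang t (w ord0 j0)).
  by apply/funext => u; rewrite mxE.
rewrite (_ : (fun w => _) = (fun w : 'rV[R]_2 => w ord0 j1) + (fun w : 'rV[R]_2 => stretch t (w ord0 j0))).
  have [d1 e1] := derive_comp_coord v (is_derive_stretch t (w ord0 j0)).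
  have [d2 e2] := derive_comp_coord v (is_derive_id (w ord0 j1) (1 : R)).
  by rewrite deriveD// e1 e2 mul1r.
by apply/funext => u; rewrite mxE.
Qed.

(** * The dominated splitting of the base map *)

Let N := flat_riemannian (torus 2).

Definition unit_row (a : R) : 'rV[R]_2 := row_of 2 [:: cos a; sin a].
Definition normal_row (a : R) : 'rV[R]_2 := row_of 2 [:: - sin a; cos a].

(* Up to the factor [exp (- y)], [unit_row a] and [normal_row a] are the constant
   vectors (0, 1) and (1, 0) of the plane written in the coordinates (a, y). *)
Definition base_E (x : flat (torus 2)) := <[unit_row (flat_repr x ord0 j0)]>%VS.
Definition base_F (x : flat (torus 2)) := <[normal_row (flat_repr x ord0 j0)]>%VS.

Lemma cos_sin_repr w : cos (flat_repr (flat_proj (torus 2) w) ord0 j0) = cos (w ord0 j0) /\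
  sin (flat_repr (flat_proj (torus 2) w) ord0 j0) = sin (w ord0 j0).
Proof.
have /flat_projP /(_ j0)[m] := flat_reprK (flat_proj (torus 2) w).
rewrite !mxE => /eqP; rewrite subr_eq addrC => /eqP ->.
exact: cos_sin_period.
Qed.

Lemma unit_row_repr w : unit_row (flat_repr (flat_proj (torus 2) w) ord0 j0) = unit_row (w ord0 j0).
Proof. by rewrite /unit_row; have [-> ->] := cos_sin_repr w. Qed.

Lemma normal_row_repr w :
  normal_row (flat_repr (flat_proj (torus 2) w) ord0 j0) = normal_row (w ord0 j0).
Proof. by rewrite /normal_row; have [-> ->] := cos_sin_repr w. Qed.

(** The linear map multiplies the vector (0, 1) by exp(-t). Here it is rescaled by the radius exp y,
    which the flow multiplies by [Num.sqrt (rho2 t a)]; the factor is the quotient. *)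
Lemma psi_unit t x :
  tangent_map (M := N) (N := N) (psi t) x (unit_row (flat_repr x ord0 j0)) =
  (expR (- t) / Num.sqrt (rho2 t (flat_repr x ord0 j0))) *:
    unit_row (flat_repr (psi t x) ord0 j0).
Proof.
set w := flat_repr x; set a := w ord0 j0.
rewrite (flat_tangent_map _ (base_flow_smooth t) (psiE t) (flat_reprK x)) base_flow_derive.
rewrite -[in RHS](flat_reprK x) psiE unit_row_repr -/w /unit_row [base_flow t w ord0 j0]mxE /=.
have [-> ->] := cos_sin_ang t a; set r := Num.sqrt _.
have r0 : r != 0 by rewrite gt_eqF// sqrtr_gt0 rho2_gt0.
have rE : rho2 t a = r ^+ 2 by rewrite sqr_sqrtr// ltW// rho2_gt0.
have r2 : r ^+ 2 = cos a ^+ 2 + expR (- t) ^+ 2 * sin a ^+ 2 by rewrite -rE.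
have cs := cos2sin2 a; rewrite -/a.
apply/rowP => j; rewrite !mxE; have [->|->] := ord2P j; rewrite /= rE.
  by field.
apply: (mulIf (expf_neq0 2 r0)).
transitivity (sin a * r ^+ 2 + (expR (- t) ^+ 2 - 1) * (sin a * cos a) * cos a); first by field.
transitivity (expR (- t) * (expR (- t) * sin a)); last by field.
by rewrite r2; ring: cs.
Qed.

(** The same computation for the vector (1, 0), whose eigenvalue is 1. *)
Lemma psi_normal t x :
  tangent_map (M := N) (N := N) (psi t) x (normal_row (flat_repr x ord0 j0)) =
  (Num.sqrt (rho2 t (flat_repr x ord0 j0)))^-1 *:
    normal_row (flat_repr (psi t x) ord0 j0).
Proof.
set w := flat_repr x; set a := w ord0 j0.
rewrite (flat_tangent_map _ (base_flow_smooth t) (psiE t) (flat_reprK x)) base_flow_derive.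
rewrite -[in RHS](flat_reprK x) psiE normal_row_repr -/w /normal_row [base_flow t w ord0 j0]mxE /=.
have [-> ->] := cos_sin_ang t a; set r := Num.sqrt _.
have r0 : r != 0 by rewrite gt_eqF// sqrtr_gt0 rho2_gt0.
have rE : rho2 t a = r ^+ 2 by rewrite sqr_sqrtr// ltW// rho2_gt0.
have r2 : r ^+ 2 = cos a ^+ 2 + expR (- t) ^+ 2 * sin a ^+ 2 by rewrite -rE.
have cs := cos2sin2 a; rewrite -/a.
apply/rowP => j; rewrite !mxE; have [->|->] := ord2P j; rewrite /= rE.
  by field.
apply: (mulIf (expf_neq0 2 r0)).
transitivity (cos a * r ^+ 2 - (expR (- t) ^+ 2 - 1) * (sin a * cos a) * sin a); first by field.
transitivity (cos a); last by field.
by rewrite r2; ring: cs.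
Qed.

Lemma unit_row_norm x a : tnorm (M := N) x (unit_row a) = 1.
Proof.
rewrite flat_tnorm !big_ord_recl big_ord0 !mxE /= addr0 cos2Dsin2.
exact: sqrtr1.
Qed.

Lemma normal_row_norm x a : tnorm (M := N) x (normal_row a) = 1.
Proof.
rewrite flat_tnorm !big_ord_recl big_ord0 !mxE /= addr0 sqrrN addrC cos2Dsin2.
exact: sqrtr1.
Qed.

Lemma row_norm_neq0 x v : tnorm (M := N) x v = 1 -> v != 0.
Proof.
apply: contra_eq_neq => ->; rewrite flat_tnorm big1 ?sqrtr0; last by move=> i _; rewrite mxE expr0n.
by rewrite eq_sym oner_eq0.
Qed.

Lemma line_opnorm_le (f : flat (torus 2) -> flat (torus 2)) x v v' c : 0 <= c ->
  tnorm (M := N) x v = 1 -> tnorm (M := N) (f x) v' = 1 ->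
  tangent_map (M := N) (N := N) f x v = c *: v' -> opnorm (M := N) f x <[v]>%VS <= c.
Proof.
move=> c0 v1 v1' fv; apply: opnorm_le => // u /vlineP[b ->].
by rewrite linearZ/= fv !flat_tnormZ v1 v1' !mulr1 mulrC (ger0_norm c0).
Qed.

(** The choice of representative [flat_repr] need not be continuous; a function of the cosine and
    sine of the angle does not see it and factors through the quotient. *)
Lemma rot_row_continuous (p : R -> R * R) :
  continuous (fun a => (p a).1) -> continuous (fun a => (p a).2) ->
  (forall a b, cos a = cos b -> sin a = sin b -> p a = p b) ->
  continuous (fun x : flat (torus 2) =>
    row_of 2 [:: (p (flat_repr x ord0 j0)).1; (p (flat_repr x ord0 j0)).2]).
Proof.
move=> c1 c2 pE; apply/quotient_continuous.
rewrite (_ : _ \o _ = (fun w : 'rV[R]_2 => row_of 2 [:: (p (w ord0 j0)).1; (p (w ord0 j0)).2])).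
  move=> w; apply: continuous_row => j.
  have cj : {for w, continuous (fun w : 'rV[R]_2 => w ord0 j0)} by exact: coord_continuous.
  have [->|->] := ord2P j.
    rewrite (_ : (fun x => _) = (fun a => (p a).1) \o (fun w : 'rV[R]_2 => w ord0 j0)).
      by apply: continuous_comp => //; exact: c1.
    by apply/funext => u; rewrite mxE.
  rewrite (_ : (fun x => _) = (fun a => (p a).2) \o (fun w : 'rV[R]_2 => w ord0 j0)).
    by apply: continuous_comp => //; exact: c2.
  by apply/funext => u; rewrite mxE.
by apply/funext => w /=; have [c s] := cos_sin_repr w; rewrite -(pE _ _ c s).
Qed.

Lemma base_splitting t : continuous_invariant_splitting (M := N)
  (iterz (psi t) (psi (- t))) setT base_E base_F.
Proof.
have u0 a : unit_row a != 0 := row_norm_neq0 (unit_row_norm (flat_proj _ 0) a).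
have n0 a : normal_row a != 0 := row_norm_neq0 (normal_row_norm (flat_proj _ 0) a).
have iterE k : iterz (psi t) (psi (- t)) k = psi (t *~ k).
  by apply/funext => x; exact: psi_iterz.
split.
- move=> x _; set a := flat_repr x ord0 j0; have cs := cos2sin2 a; split.
  + by rewrite -dimv_eq0 dim_vline u0.
  + by rewrite -dimv_eq0 dim_vline n0.
  + apply/eqP; rewrite eqEsubv subvf /=; apply/subvP => v _; apply/memv_addP.
    exists ((v ord0 j0 * cos a + v ord0 j1 * sin a) *: unit_row a).
      by rewrite memvZ// memv_line.
    exists ((- v ord0 j0 * sin a + v ord0 j1 * cos a) *: normal_row a).
      by rewrite memvZ// memv_line.
    by apply/rowP => j; rewrite !mxE; have [->|->] := ord2P j => /=; ring: cs.
  + apply/eqP; rewrite -subv0; apply/subvP => v.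
    rewrite memv_cap memv0 => /andP[/vlineP[c ->] /vlineP[d]].
    rewrite -/a => /rowP E; have := E j0; have := E j1; rewrite !mxE /= => E1 E0.
    suff -> : c = 0 by rewrite scale0r.
    have : c * (cos a ^+ 2 + sin a ^+ 2) = 0.
      transitivity ((c * cos a) * cos a + (c * sin a) * sin a); first by ring.
      by rewrite E0 E1; ring.
    by rewrite cos2Dsin2 mulr1.
- apply: (@flat_continuous_subbundle _ _ _ _ _ 1
    (fun i x => [:: unit_row (flat_repr x ord0 j0)]`_i)).
    move=> i; rewrite (ord1 i) /=; apply: (@rot_row_continuous (fun a => (cos a, sin a))) => /=.
    + exact: continuous_cos.
    + exact: continuous_sin.
    + by move=> a b -> ->.
  by move=> x; rewrite map_nth_enum_ord// /basis_of span_seq1 eqxx seq1_free u0.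
- apply: (@flat_continuous_subbundle _ _ _ _ _ 1
    (fun i x => [:: normal_row (flat_repr x ord0 j0)]`_i)).
    move=> i; rewrite (ord1 i) /=; apply: (@rot_row_continuous (fun a => (- sin a, cos a))) => /=.
    + by move=> a; apply: cvgN; exact: continuous_sin.
    + exact: continuous_cos.
    + by move=> a b -> ->.
  by move=> x; rewrite map_nth_enum_ord// /basis_of span_seq1 eqxx seq1_free n0.
- move=> k x _; rewrite iterE limg_line psi_unit vlineZ//.
  by rewrite mulf_neq0 ?invr_neq0// gt_eqF ?expR_gt0// sqrtr_gt0 rho2_gt0.
- move=> k x _; rewrite iterE limg_line psi_normal vlineZ//.
  by rewrite invr_neq0// gt_eqF// sqrtr_gt0 rho2_gt0.
Qed.

(** The radius factor is common to both lines and cancels, leaving the ratio exp(-s) of the two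
    eigenvalues at every point. The constant 2 makes the inequality strict. *)
Lemma base_dominated t : 0 < t ->
  diffeo_dominated_splitting (M := N) (psi t) (psi (- t)) setT base_E base_F.
Proof.
move=> t0; split; first exact: base_splitting.
exists 2, t; split=> // x k _ k0.
have iterE l : iterz (psi t) (psi (- t)) l = psi (t *~ l).
  by apply/funext => y; exact: psi_iterz.
rewrite !iterE mulrNz mulrzr; set s := t *~ k; set a := flat_repr x ord0 j0.
have r0 := rho2_gt0 s a.
(* Growth backward from the image point inverts growth forward: the cocycle rule at total time 0. *)
have rV : rho2 (- s) (flat_repr (psi s x) ord0 j0) = (rho2 s a)^-1.
  rewrite -[x in psi s x]flat_reprK psiE /rho2.
  have [-> ->] := cos_sin_repr (base_flow s (flat_repr x)).
  rewrite mxE/= -/(rho2 (- s) (ang s a)) rho2_ang addNr.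
  by rewrite {1}/rho2 oppr0 expR0 expr1n mul1r cos2Dsin2 div1r.
have h1 : opnorm (M := N) (psi s) x (base_E x) <= expR (- s) / Num.sqrt (rho2 s a).
  apply: line_opnorm_le (psi_unit s x); [|exact: unit_row_norm|exact: unit_row_norm].
  by rewrite divr_ge0 ?expR_ge0 ?sqrtr_ge0.
have h2 : opnorm (M := N) (psi (- s)) (psi s x) (base_F (psi s x)) <= Num.sqrt (rho2 s a).
  rewrite -[leRHS]invrK -sqrtrV ?(ltW r0)// -rV.
  apply: line_opnorm_le (psi_normal (- s) (psi s x)); [|exact: normal_row_norm|exact: normal_row_norm].
  by rewrite invr_ge0 sqrtr_ge0.
apply: (@le_lt_trans _ _ (expR (- s))); last by rewrite ltr_pMl ?expR_gt0// ltr1n.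
apply: (le_trans (ler_pM _ _ h1 h2)); [exact: opnorm_ge0|exact: opnorm_ge0|].
by rewrite divfK// gt_eqF// sqrtr_gt0.
Qed.

End Torus.

(** * The suspension *)

Section Suspension.
Variable R : realType.

Local Notation j0 := (@Ordinal 2 0 isT).
Local Notation j1 := (@Ordinal 2 1 isT).
Local Notation T2 := (torus R 2).
Local Notation T3 := (torus R (2 + 1)).
Local Notation k2 := (rshift 2 (ord0 : 'I_1)).

(** [sus_proj] shears [(x, s)] into [(psi s x, s)], which turns the translation flow in the second
    coordinate into this product flow. *)
Definition sus_lift (t : R) (w : 'rV[R]_(2 + 1)) : 'rV[R]_(2 + 1) :=
  row_mx (base_flow t (lsubmx w)) (w ord0 k2 + t)%:M.

Definition sus (t : R) : flat T3 -> flat T3 := descend T3 (sus_lift t).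

Lemma Ck_lsubmx m n k i : Ck k setT (fun w : 'rV[R]_(m + n) => lsubmx w ord0 i).
Proof.
apply: (@Ck_ext R _ _ _ _ (fun w : 'rV[R]_(m + n) => w ord0 (lshift n i))).
  by move=> w; rewrite mxE.
exact: Ck_coord.
Qed.

Lemma Ck_rsubmx m n k i : Ck k setT (fun w : 'rV[R]_(m + n) => rsubmx w ord0 i).
Proof.
apply: (@Ck_ext R _ _ _ _ (fun w : 'rV[R]_(m + n) => w ord0 (rshift m i))).
  by move=> w; rewrite mxE.
exact: Ck_coord.
Qed.

Lemma Ck_row_mx (V : normedModType R) n k (f : V -> 'rV[R]_n) (s : V -> R) :
  (forall i, Ck k setT (fun x => f x ord0 i)) -> Ck k setT s ->
  Ck k setT (fun x => row_mx (f x) (s x)%:M : 'rV[R]_(n + 1)).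
Proof.
move=> kf ks; apply: Ck_row => i; case: (split_ordP i) => j ->.
  by apply: (Ck_ext _ (kf j)) => x; rewrite row_mxEl.
by apply: (@Ck_ext R _ _ _ _ s) => // x; rewrite row_mxEr !ord1 mxE mulr1n.
Qed.

Lemma Ck_coords (V : normedModType R) n k (f : V -> 'rV[R]_n) i :
  Ck k setT f -> Ck k setT (fun x => f x ord0 i).
Proof.
elim: k f => [|k IH] f.
  by move=> cf x _; apply: (@continuous_comp _ _ _ f (fun w => w ord0 i)); [exact: cf|exact: coord_continuous].
move=> [df Df]; split=> [x _|v].
  apply: (@differentiable_comp _ _ _ _ f (fun w => w ord0 i)); first exact: df.
  exact: differentiable_coord.
apply: (Ck_ext _ (IH _ (Df v))) => x.
by rewrite derive_mx ?mxE//; exact/diff_derivable/df.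
Qed.

Lemma sus_lift_smooth t : smooth_on setT (sus_lift t).
Proof.
move=> k; apply: Ck_row_mx.
  move=> i; apply: Ck_coords; apply: (@Ck_base_flow _ _ _ (cst t)); first exact: Ck_const.
  by move=> j; exact: Ck_lsubmx.
by apply: Ck_add; [exact: Ck_coord|exact: Ck_const].
Qed.

Lemma torus_row_mx (u : 'rV[R]_2) (s : R) :
  T3 (row_mx u s%:M) <-> T2 u /\ exists m : int, s = period R *~ m.
Proof.
split=> [H|[Hu [m ->]] i].
  split=> [i|].
    by have [m] := H (lshift 1 i); rewrite row_mxEl => ->; exists m.
  by have [m] := H k2; rewrite row_mxEr mxE mulr1n => ->; exists m.
case: (split_ordP i) => j ->; first by rewrite row_mxEl; exact: Hu.
by exists m; rewrite row_mxEr !ord1 mxE mulr1n.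
Qed.

Lemma row_mxB (u u' : 'rV[R]_2) (s s' : R) :
  row_mx u s%:M - row_mx u' s'%:M = row_mx (u - u') (s - s')%:M.
Proof. by rewrite opp_row_mx add_row_mx raddfB. Qed.

Lemma torus_projP (u u' : 'rV[R]_2) (s s' : R) :
  flat_proj T3 (row_mx u s%:M) = flat_proj T3 (row_mx u' s'%:M) <->
  flat_proj T2 u = flat_proj T2 u' /\ exists m : int, s - s' = period R *~ m.
Proof.
split=> [/flat_projP|[/flat_projP Hu Hs]].
  by rewrite row_mxB => /torus_row_mx[Hu Hs]; split=> //; exact/flat_projP.
by apply/flat_projP; rewrite row_mxB; apply/torus_row_mx.
Qed.

Lemma row_mxK (w : 'rV[R]_(2 + 1)) : row_mx (lsubmx w) (w ord0 k2)%:M = w.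
Proof.
rewrite -[RHS]hsubmxK; congr row_mx.
by apply/rowP => i; rewrite !ord1 !mxE mulr1n.
Qed.

Lemma sus_lift_equivariant t : equivariant T3 T3 (sus_lift t).
Proof.
move=> u g Gg; rewrite /sus_lift row_mxB; apply/torus_row_mx.
have := Gg; rewrite -(row_mxK g) => /torus_row_mx[Gl [m gm]]; split.
  by rewrite linearD /=; have := base_flow_equivariant t (lsubmx u) Gl; rewrite row_mxK.
by exists m; rewrite row_mxK mxE gm; ring.
Qed.

Lemma susE t w : sus t (flat_proj T3 w) = flat_proj T3 (sus_lift t w).
Proof. exact/descendE/sus_lift_equivariant. Qed.

Lemma sus_lift_row t (u : 'rV[R]_2) (s : R) :
  sus_lift t (row_mx u s%:M) = row_mx (base_flow t u) (s + t)%:M.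
Proof. by rewrite /sus_lift row_mxKl row_mxEr mxE mulr1n. Qed.

(* Since the return map is the time-[period] map of the flow [psi], the mapping
   torus is the product of the 2-torus with a circle. *)
Definition sus_proj (z : flat T2 * R) : flat T3 :=
  flat_proj T3 (row_mx (base_flow z.2 (flat_repr z.1)) z.2%:M).

Lemma sus_projE u s : sus_proj (flat_proj T2 u, s) = flat_proj T3 (row_mx (base_flow s u) s%:M).
Proof.
apply/torus_projP; split; last by exists 0; rewrite subrr mulr0z.
by rewrite -!psiE flat_reprK.
Qed.

Lemma sus_sus_proj t x s : sus t (sus_proj (x, s)) = sus_proj (x, s + t).
Proof.
rewrite -(flat_reprK x) !sus_projE susE sus_lift_row.
by rewrite [s + t]addrC base_flowD [t + s]addrC.
Qed.

Definition glue (z : flat T2 * R) : flat T2 * R := (psi (period R) z.1, z.2 - period R).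

Lemma iter_glue k x s : iter k glue (x, s) = (psi (period R *+ k) x, s - period R *+ k).
Proof.
elim: k => [|k IH] /=; first by rewrite mulr0n psi0 subr0.
rewrite IH /glue /= -psiD mulrS; congr pair; by rewrite -addrA -opprD [X in _ - X]addrC.
Qed.

(** The shear absorbs the gluing: [psi] for time s - k P after [psi] for time k P is [psi] for time
    s, and the circle coordinate changes by a multiple of the period P. *)
Lemma sus_proj_iter_glue k z : sus_proj (iter k glue z) = sus_proj z.
Proof.
case: z => x s; rewrite iter_glue -(flat_reprK x) psiE !sus_projE.
apply/torus_projP; split; first by rewrite -!psiE -psiD subrK.
by exists (- k%:Z); rewrite mulrNz pmulrn; ring.
Qed.

Lemma sus_proj_eq z w : sus_proj z = sus_proj w <->
  exists k : nat, iter k glue z = w \/ iter k glue w = z.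
Proof.
split=> [|[k [<-|<-]]]; rewrite ?sus_proj_iter_glue//.
case: z w => x s [y r].
rewrite -{1}(flat_reprK x) -{1}(flat_reprK y) !sus_projE => /torus_projP[+ [m sr]].
rewrite -!psiE !flat_reprK => xy.
have yx : y = psi (s - r) x by rewrite addrC psiD xy -psiD addNr psi0.
have xy' : x = psi (r - s) y by rewrite addrC psiD -xy -psiD addNr psi0.
(* The sign of [m] decides which of the two points gets iterated; [Negz k] stands for -(k + 1),
   hence [k.+1] iterations. *)
case: m sr => k; rewrite ?NegzE ?mulrNz -pmulrn => sr; [exists k; left|exists k.+1; right].
  by rewrite iter_glue yx -sr opprB addrCA subrr addr0.
have {}sr : r - s = period R *+ k.+1 by rewrite -opprB sr opprK.
by rewrite iter_glue xy' -sr opprB addrCA subrr addr0.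
Qed.

Lemma sus_proj_surj : set_surj [set: flat T2 * R] [set: flat T3] sus_proj.
Proof.
move=> x _; rewrite -(flat_reprK x) -(row_mxK (flat_repr x)).
set u := lsubmx _; set s := _ ord0 k2.
by exists (flat_proj T2 (base_flow (- s) u), s) => //; rewrite sus_projE -base_flowD subrr base_flow0.
Qed.

Lemma sus_proj_smooth :
  smooth_map (prod_atlas (@flat_chart R 2 T2)) (@flat_chart R (2 + 1) T3) sus_proj.
Proof.
apply: (@flat_smooth_map_prod _ _ _ _ _ (fun w : 'rV[R]_(2 + 1) =>
  row_mx (base_flow (rsubmx w ord0 ord0) (lsubmx w)) (rsubmx w ord0 ord0)%:M)).
  move=> k; apply: Ck_row_mx; last exact: Ck_rsubmx.
  move=> i; apply: Ck_coords; apply: Ck_base_flow; first exact: Ck_rsubmx.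
  by move=> j; exact: Ck_lsubmx.
by move=> w s; rewrite sus_projE row_mxKl row_mxKr mxE mulr1n.
Qed.

(** The lift [(h, b)] may depend on the point. This is needed for [sus_inv]: its second component is
    real valued, and its formula changes by a multiple of the period from one lifted copy of the
    domain to the next. *)
Lemma flat_smooth_map_on_prod m n (G : lattice R m) (H : lattice R n) (O : set (flat G))
    (f : flat G -> flat H * R) :
  (forall w, O (flat_proj G w) -> exists (h : 'rV[R]_m -> 'rV[R]_n) (b : 'rV[R]_m -> R),
     [/\ smooth_on setT h, smooth_on setT b
       & \near w, f (flat_proj G w) = (flat_proj H (h w), b w)]) ->
  smooth_map_on (@flat_chart R m G) (prod_atlas (@flat_chart R n H)) O f.
Proof.
move=> loc; split.
  apply: continuous_in_subspaceT => x /[!inE]; rewrite -(flat_reprK x); set w := flat_repr x => Ow.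
  have [h [b [sh sb fE]]] := loc w Ow.
  have cw : {for w, continuous (fun w => (flat_proj H (h w), b w))}.
    have c1 : {for w, continuous (flat_proj H \o h)}.
      by apply: (@continuous_comp _ _ _ h (flat_proj H)); [exact: (sh 0)|exact: flat_proj_continuous].
    have c2 : {for w, continuous b} by exact: (sb 0).
    exact: (cvg_pair c1 c2).
  move=> A; rewrite (nbhs_singleton fE) => /cw Aw0.
  have Aw : \forall v \near w, A (flat_proj H (h v), b v) by exact: Aw0.
  have : nbhs w (fun w => A (f (flat_proj G w))).
    by apply: filterS2 fE Aw => v ->.
  move=> /(@flat_proj_nbhs _ _ G) Pw; have fA : nbhs (flat_proj G w) (f @^-1` A); last exact: fA.
  by apply: filterS Pw => _ [v Av <-].
move=> p q k; apply: Ck_near => _ [x [[Ox px] qx] <-].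
have [_ xE] := flat_chart_mapK px; rewrite -xE in Ox qx; move: Ox qx.
set w := chart_map _ x => Ow qw.
have [h [b [sh sb fE]]] := loc w Ow.
have [||g _ Hg] := @flat_chart_near _ _ H _ h w q.1; first exact: (sh 0).
  by have [+ _] := qw; rewrite (nbhs_singleton fE).
exists (fun v => row_mx (h v + g) (b v)%:M); split; last first.
  apply: Ck_row_mx; last exact: sb.
  by move=> i; apply: Ck_coords; apply: Ck_add; [exact: sh|exact: Ck_const].
near=> v.
have E : f (flat_proj G v) = (flat_proj H (h v), b v) by near: v; exact: fE.
have E2 : chart_map (flat_chart q.1) (flat_proj H (h v)) = h v + g by near: v; exact: Hg.
by rewrite -E2 /= E.
Unshelve. all: by end_near. Qed.

(** Lifts the circle coordinate to the interval of radius 1 around [s0]; the lift is unique since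
    the period is at least 2. The default 0 occurs only when no lift falls in the interval. *)
Definition sus_time (s0 : R) (x : flat T3) : R :=
  xget 0 [set s | `|s0 - s| < 1 /\ exists u, x = flat_proj T3 (row_mx u s%:M)].

Lemma sus_timeE s0 (u : 'rV[R]_2) s : `|s0 - s| < 1 ->
  sus_time s0 (flat_proj T3 (row_mx u s%:M)) = s.
Proof.
move=> s1; rewrite /sus_time; case: xgetP => [r _ [r1 [v /torus_projP[_ [m sr]]]]|/(_ s)/=].
  apply/esym/subr0_eq; rewrite sr; apply: period_discrete; rewrite -sr.
  by move: s1 r1; rewrite !ltr_norml => /andP[? ?] /andP[? ?]; apply/andP; split; lra.
by case; split=> //; exists u.
Qed.

Definition sus_inv (s0 : R) (x : flat T3) : flat T2 * R :=
  (psi (- sus_time s0 x) (flat_proj T2 (lsubmx (flat_repr x))), sus_time s0 x).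

Lemma sus_invE s0 (u : 'rV[R]_2) s : `|s0 - s| < 1 ->
  sus_inv s0 (flat_proj T3 (row_mx u s%:M)) = (flat_proj T2 (base_flow (- s) u), s).
Proof.
move=> s1; rewrite /sus_inv sus_timeE// -psiE; congr (psi _ _, _).
set w := flat_repr _; have : flat_proj T3 w = flat_proj T3 (row_mx u s%:M) by exact: flat_reprK.
by rewrite -{1}(row_mxK w) => /torus_projP[].
Qed.

Lemma sus_proj_local z : exists U : set (flat T2 * R),
  [/\ open U, U z, open (sus_proj @` U)
    & exists2 inv : flat T3 -> flat T2 * R,
        smooth_map_on (@flat_chart R (2 + 1) T3) (prod_atlas (@flat_chart R 2 T2))
          (sus_proj @` U) inv
      & forall w, U w -> inv (sus_proj w) = w].
Proof.
case: z => x0 s0; pose U : set (flat T2 * R) := [set z | `|s0 - z.2| < 1].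
have UE : sus_proj @` U = flat_proj T3 @` [set w : 'rV[R]_(2 + 1) | `|s0 - w ord0 k2| < 1].
  apply/seteqP; split=> y [].
    move=> [x s] /= s1 <-; exists (row_mx (base_flow s (flat_repr x)) s%:M) => //=.
    by rewrite row_mxEr mxE mulr1n.
  move=> w /= w1 <-; exists (flat_proj T2 (base_flow (- w ord0 k2) (lsubmx w)), w ord0 k2) => //.
  by rewrite sus_projE -base_flowD subrr base_flow0 row_mxK.
have oball (T : topologicalType) (h : T -> R) : continuous h -> open [set x | `|s0 - h x| < 1].
  move=> /continuousP/(_ (ball s0 1) (ball_open _ _)).
  by rewrite (_ : _ @^-1` _ = [set x | `|s0 - h x| < 1]).
exists U; split.
- by apply: oball => -[x s]; exact: cvg_snd.
- by rewrite /U/= subrr normr0.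
- by rewrite UE; apply/flat_proj_open/oball/coord_continuous.
- exists (sus_inv s0); last first.
    by move=> [x s] /= s1; rewrite -(flat_reprK x) sus_projE sus_invE// -base_flowD addNr base_flow0.
  apply: flat_smooth_map_on_prod => w; rewrite UE => -[v /= v1 /esym].
  rewrite -{1}(row_mxK w) -{1}(row_mxK v) => /torus_projP[_ [m wv]].
  (* Subtracting [m] periods brings the last coordinate of [w] into the interval where [sus_time]
     reads it off. *)
  pose b (w' : 'rV[R]_(2 + 1)) := w' ord0 k2 - period R *~ m.
  exists (fun w' => base_flow (- b w') (lsubmx w')), b.
  have sb : smooth_on setT b.
    by move=> k; apply: Ck_add; [exact: Ck_coord|exact: Ck_const].
  split=> //.
    move=> k; apply: Ck_base_flow; first by apply: Ck_opp; exact: sb.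
    by move=> j; exact: Ck_lsubmx.
  have ob : open [set w' | `|s0 - b w'| < 1] by apply: oball => u; exact: (sb 0).
  have bw : `|s0 - b w| < 1 by rewrite /b -wv subKr.
  have : nbhs w [set w' | `|s0 - b w'| < 1] by exact: open_nbhs_nbhs.
  apply: filterS => w' /= bw'; rewrite -(sus_invE _ bw'); congr sus_inv.
  rewrite -{1}(row_mxK w'); apply/torus_projP; split=> //.
  by exists m; rewrite /b subKr.
Qed.

Lemma sus_is_suspension :
  is_suspension (N := flat_manifold T2) (M := flat_manifold T3)
    (psi (period R)) (fun=> period R) sus.
Proof.
exists sus_proj; split.
- exact: sus_proj_surj.
- exact: sus_proj_eq.
- exact: sus_proj_smooth.
- exact: sus_proj_local.
- exact: sus_sus_proj.
Qed.

End Suspension.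

(** * No splitting of the suspension is dominated *)

Section SuspensionNotDominated.
Variable R : realType.

Local Notation j0 := (@Ordinal 2 0 isT).
Local Notation j1 := (@Ordinal 2 1 isT).
Local Notation T2 := (torus R 2).
Local Notation T3 := (torus R (2 + 1)).
Local Notation k0 := (lshift 1 j0).
Local Notation k1 := (lshift 1 j1).
Local Notation k2 := (rshift 2 (ord0 : 'I_1)).
Let M := flat_riemannian T3.

Definition sus_rate (t a : R) (i : 'I_(2 + 1)) : R :=
  if i == ord0 then expR (- t) / rho2 t a else 1.

(** The only off-diagonal entry is the derivative of [stretch] in the angle, a multiple of sine
    times cosine; it vanishes at both angles of interest. *)
Lemma sus_lift_derive t (w v : 'rV[R]_(2 + 1)) i : sin (w ord0 k0) * cos (w ord0 k0) = 0 ->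
  derive (sus_lift t) w v ord0 i = sus_rate t (w ord0 k0) i * v ord0 i.
Proof.
move=> sc0; rewrite derive_coord; last exact: sus_lift_smooth.
have did j : is_derive (w ord0 j) (1 : R) id 1 by exact: is_derive_id.
have [d1 e1] := derive_comp_coord v (is_derive_stretch t (w ord0 k0)).
case: (split_ordP i) => j ->; last first.
  rewrite (_ : (fun _ => _) = (fun w : 'rV[R]_(2 + 1) => w ord0 k2) + cst t).
    have [d2 e2] := derive_comp_coord v (did k2).
    by rewrite deriveD// e2 derive_cst addr0 (ord1 j).
  by apply/funext => u; rewrite row_mxEr (ord1 j) mxE mulr1n.
have [->|->] := ord2P j.
  rewrite (_ : (fun _ => _) = (fun w : 'rV[R]_(2 + 1) => ang t (w ord0 k0))).
    have [_ ->] := derive_comp_coord v (is_derive_ang t (w ord0 k0)).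
    by [].
  by apply/funext => u; rewrite row_mxEl !mxE.
rewrite (_ : (fun _ => _) = (fun w : 'rV[R]_(2 + 1) => w ord0 k1)
   + (fun w : 'rV[R]_(2 + 1) => stretch t (w ord0 k0))).
  have [d2 e2] := derive_comp_coord v (did k1).
  by rewrite deriveD// e1 e2 sc0 mulr0 !mul0r addr0.
by apply/funext => u; rewrite row_mxEl !mxE.
Qed.

Definition sus_pt (a : R) : flat T3 := flat_proj T3 (row_mx (row_of 2 [:: a]) 0%:M).

Lemma sus_pt_continuous : continuous sus_pt.
Proof.
move=> a; apply: (@continuous_comp _ _ _ (fun a : R => row_mx (row_of 2 [:: a]) 0%:M)).
  apply: continuous_row_mx; last exact: cvg_cst.
  apply: continuous_row => j.
  rewrite (_ : (fun x => _) = (fun x : R => [:: x]`_j)); last first.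
    by apply/funext => x; rewrite mxE.
  by have [->|->] := ord2P j; [exact: cvg_id|exact: cvg_cst].
exact: flat_proj_continuous.
Qed.

Lemma sus_tangent t a v i : sin a * cos a = 0 ->
  tangent_map (M := M) (N := M) (sus t) (sus_pt a) v ord0 i = sus_rate t a i * v ord0 i.
Proof.
move=> sc0.
rewrite (@flat_tangent_map _ _ _ _ _ _ _ _ _ v (@sus_lift_smooth _ t) (@susE _ t) (erefl (sus_pt a))).
have wE : (row_mx (row_of 2 [:: a]) 0%:M : 'rV[R]_(2 + 1)) ord0 k0 = a by rewrite row_mxEl mxE.
by rewrite sus_lift_derive wE.
Qed.

(** The circle coordinate returns after a multiple of the period. The log-radius only has to return
    modulo the period, which happens at angle pi/2 because [stretch] is there minus the elapsed
    time. *)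
Lemma sus_pt_fixed m a : (exists2 l : int, stretch (period R *~ m) a = period R *~ l & ang (period R *~ m) a = a) ->
  sus (period R *~ m) (sus_pt a) = sus_pt a.
Proof.
move=> [l sE aE]; rewrite /sus_pt susE sus_lift_row; apply/torus_projP; split; last first.
  by exists m; rewrite add0r subr0.
apply/flat_projP => j; rewrite !mxE; have [->|->] := ord2P j; rewrite /= ?mxE/= ?mxE/=.
  by exists 0; rewrite aE subrr mulr0z.
by exists l; rewrite add0r subr0.
Qed.

Lemma sus_pt_fixed0 m : sus (period R *~ m) (sus_pt 0) = sus_pt 0.
Proof. by apply: sus_pt_fixed; exists 0; [rewrite stretch0 mulr0z|rewrite ang0]. Qed.

Lemma sus_pt_fixed_pihalf m : sus (period R *~ m) (sus_pt (pi / 2)) = sus_pt (pi / 2).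
Proof.
by apply: sus_pt_fixed; exists (- m); [rewrite stretch_pihalf mulrNz|rewrite ang_pihalf].
Qed.

Lemma dim_locally_constant n (G : lattice R n) (E : flat G -> {vspace 'rV[R]_n}) x :
  continuous_subbundle (M := flat_manifold G) setT E ->
  \forall y \near x, \dim (E y) = \dim (E x).
Proof.
move=> /(_ x I)[k [e [U [oU Ux Udom _ bU]]]].
have dimE y : U y -> \dim (E y) = k.
  move=> Uy; have := bU y (conj Uy I); rewrite flat_tangent_coord_img; last exact: Udom.
  by move=> /andP[/eqP <- /eqnP ->]; rewrite size_map size_enum_ord.
have : nbhs x U by exact: open_nbhs_nbhs.
by apply: filterS => y Uy; rewrite !dimE.
Qed.

(** Level sets are open and closed in a connected line. Applied to the dimension of [E] along the
    path [sus_pt] joining the two periodic orbits. *)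
Lemma locally_constant_real (T : Type) (f : R -> T) :
  (forall s, \forall r \near s, f r = f s) -> forall a b, f a = f b.
Proof.
move=> fl a b.
have cR : connected [set: R] by apply/connected_intervalP.
have oB (P : T -> Prop) : open [set s | P (f s)].
  by rewrite openE => s /= Ps; have := fl s; apply: filterS => r rs; rewrite /= rs.
have : [set s | f s = f b] = setT.
  apply: cR; first by exists b.
  - by exists [set s | f s = f b]; rewrite ?setTI//; exact: (oB (fun y => y = f b)).
  - exists [set s | f s = f b]; rewrite ?setTI//.
    by rewrite -[X in closed X]setCK; apply: open_closedC; exact: (oB (fun y => y <> f b)).
by move=> /seteqP[_ /(_ a I)].
Qed.

Lemma sus_not_dominated (E F : flat T3 -> {vspace 'rV[R]_(2 + 1)}) :
  ~ flow_dominated_splitting (M := M) (@sus R) setT E F.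
Proof.
move=> [[EF cE _ _ _] [K [lambda [K0 l0 H]]]].
have [m m0 Km] := exp_decay_le1 K l0 (period_gt0 R).
set t := period R * m%:R in Km.
have t0 : 0 < t by rewrite mulr_gt0 ?period_gt0// ltr0n.
have tE : t = period R *~ m by rewrite -mulrzr.
(* A vector of [E] not shrunk forward and a vector of [F] not shrunk backward make both norms at
   least 1, whereas domination at time [t] puts their product below 1. *)
have not_le1 a u v : sin a * cos a = 0 -> sus t (sus_pt a) = sus_pt a ->
    u \in E (sus_pt a) -> u != 0 -> (forall i, u ord0 i != 0 -> 1 <= `|sus_rate t a i|) ->
    v \in F (sus_pt a) -> v != 0 -> (forall i, v ord0 i != 0 -> 1 <= `|sus_rate (- t) a i|) ->
    False.
  move=> sc0 fx uE u0 ud vF v0 vd.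
  have := H (sus_pt a) t I t0; rewrite fx; apply/negP; rewrite -leNgt.
  apply: (le_trans Km); rewrite -[leLHS]mulr1; apply: ler_pM => //.
    by apply: (diagonal_opnorm_ge (d := sus_rate t a)) uE u0 ud => // w i; exact: sus_tangent.
  by apply: (diagonal_opnorm_ge (d := sus_rate (- t) a)) vF v0 vd => // w i; exact: sus_tangent.
have nz (V : {vspace 'rV[R]_(2 + 1)}) : V != 0%VS -> exists2 u, u \in V & u != 0.
  by move=> V0; exists (vpick V); [exact: memv_pick|rewrite vpick0].
(* At angle 0 the forward rates are exp(-t), 1, 1. A plane inside [E] would contain a vector with
   zero first coordinate, which keeps its length, and backward no vector of [F] is shrunk. *)
have dE : (\dim (E (sus_pt 0%R)) <= 1)%N.
  rewrite leqNgt; apply/negP => dE2.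
  have [u uE [u0 uc]] := subspace_coord0 dE2.
  have [_ F0 _ _] := EF (sus_pt 0) I; have [v vF v0] := nz _ F0.
  apply: (@not_le1 0 u v) => //.
  - by rewrite sin0 mul0r.
  - by rewrite tE sus_pt_fixed0.
  - by move=> i; rewrite /sus_rate; case: (i =P ord0) => [->|_ _]; rewrite ?uc ?eqxx ?normr1.
  - move=> i _; rewrite /sus_rate; case: (i =P ord0) => [_|_]; last by rewrite normr1.
    rewrite opprK /rho2 sin0 cos0 expr1n expr0n mulr0 addr0 divr1 ger0_norm ?expR_ge0//.
    by rewrite -expR0 ler_expR ltW.
(* At angle pi/2 the first rate is exp t, so the roles of [E] and [F], and of the two time
   directions, are exchanged. *)
have dF : (\dim (F (sus_pt (pi / 2))) <= 1)%N.
  rewrite leqNgt; apply/negP => dF2.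
  have [v vF [v0 vc]] := subspace_coord0 dF2.
  have [E0 _ _ _] := EF (sus_pt (pi / 2)) I; have [u uE u0] := nz _ E0.
  apply: (@not_le1 (pi / 2) u v) => //.
  - by rewrite cos_pihalf mulr0.
  - by rewrite tE sus_pt_fixed_pihalf.
  - move=> i _; rewrite /sus_rate; case: (i =P ord0) => [_|_]; last by rewrite normr1.
    rewrite /rho2 cos_pihalf sin_pihalf expr0n/= add0r expr1n mulr1 expr2 invfM mulrA.
    rewrite divff ?gt_eqF ?expR_gt0// mul1r -expRN opprK ger0_norm ?expR_ge0//.
    by rewrite -expR0 ler_expR ltW.
  - by move=> i; rewrite /sus_rate; case: (i =P ord0) => [->|_ _]; rewrite ?vc ?eqxx ?normr1.
have dEE : \dim (E (sus_pt (pi / 2))) = \dim (E (sus_pt 0%R)).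
  apply: (@locally_constant_real _ (fun s => \dim (E (sus_pt s)))) => s.
  exact: (sus_pt_continuous (dim_locally_constant (sus_pt s) cE)).
(* At angle pi/2 both dimensions are now at most 1, yet they add up to 3. *)
have [_ _ EFs EF0] := EF (sus_pt (pi / 2)) I.
have := dimv_disjoint_sum EF0; rewrite EFs dimvf dEE => d3.
by have := leq_add dE dF; rewrite -d3 dim_matrix.
Qed.

Lemma suspension_example :
  exists (n : nat) (N : riemannian R n) (M : riemannian R (n + 1))
      (f finv : N -> N) (r : N -> R) (phi : R -> M -> M),
    (compact [set: N] /\ diffeomorphism f finv) /\
    (smooth_fun r /\ (forall x, 0 < r x)) /\
    (is_suspension f r phi) /\
    (exists E F : N -> {vspace 'rV[R]_n},
       diffeo_dominated_splitting f finv [set: N] E F) /\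
    ~ (exists E F : M -> {vspace 'rV[R]_(n + 1)},
         flow_dominated_splitting phi [set: M] E F).
Proof.
exists 2%N, (flat_riemannian T2), M, (psi (period R)), (psi (- period R)),
  (fun=> period R), (@sus R).
split; [split|split; [split|split; [|split]]].
- exact: torus_compact.
- exact: psi_diffeomorphism.
- by move=> p k; exact: Ck_const.
- by move=> x; exact: period_gt0.
- exact: sus_is_suspension.
- by exists (@base_E R), (@base_F R); apply: base_dominated; exact: period_gt0.
- by move=> [E [F]]; exact: sus_not_dominated.
Qed.

End SuspensionNotDominated.

Theorem proposition1 (R : realType) :
  (exists (n : nat) (M : riemannian R n) (X : M -> 'rV[R]_n)
      (phi : R -> M -> M) (Lambda : set M) (E F : M -> {vspace 'rV[R]_n}),
    (smooth_vector_field X /\ generates X phi) /\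
    (compact Lambda /\ invariant_set phi Lambda) /\
    (exists sigma : M, [/\ Lambda sigma, X sigma = 0
       & limit_of_regular_orbits X phi Lambda sigma]) /\
    [/\ continuous_invariant_splitting phi Lambda E F,
        uniformly_contracted phi Lambda E,
        sectionally_expanding phi Lambda F
      & ~ flow_dominated_splitting phi Lambda E F]) /\
  (exists (n : nat) (M : riemannian R n) (X : M -> 'rV[R]_n)
      (phi : R -> M -> M) (Lambda : set M) (E F : M -> {vspace 'rV[R]_n}),
    (smooth_vector_field X /\ generates X phi) /\
    (compact Lambda /\ invariant_set phi Lambda) /\
    [/\ continuous_invariant_splitting phi Lambda E F,
        uniformly_contracted phi Lambda E,
        sectionally_expanding phi Lambda F
      & ~ flow_dominated_splitting phi Lambda E F]) /\
  (exists (n : nat) (N : riemannian R n) (M : riemannian R (n + 1))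
      (f finv : N -> N) (r : N -> R) (phi : R -> M -> M),
    (compact [set: N] /\ diffeomorphism f finv) /\
    (smooth_fun r /\ (forall x, 0 < r x)) /\
    (is_suspension f r phi) /\
    (exists E F : N -> {vspace 'rV[R]_n},
       diffeo_dominated_splitting f finv [set: N] E F) /\
    ~ (exists E F : M -> {vspace 'rV[R]_(n + 1)},
         flow_dominated_splitting phi [set: M] E F)).
Proof.
split; first exact: het_example.
split; last exact: suspension_example.
have [n [M [X [phi [L [E [F [XP [LP [_ EF]]]]]]]]]] := het_example R.
by exists n, M, X, phi, L, E, F.
Qed.
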